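(* (Bad action.) The face monoid $\widehat{\mathcal W}$ acts faithfully on the Coxeter complex $\mathcal C$, as a set, by $$\sigma_1\varepsilon(R(\Theta))\sigma_2\;{}_\Box\;\tau\mathcal W_J:=\begin{cases}\sigma_1\sigma_2\tau\mathcal W_J&\text{if }\sigma_2\tau\mathcal W_J\in\mathcal W_{\Theta^\bot}(\mathcal W_\Theta\downarrow),\\ \mathcal W_I&\text{else,}\end{cases}$$ where $\sigma_1\varepsilon(R(\Theta))\sigma_2\in\widehat{\mathcal W}$ ($\sigma_1,\sigma_2\in\mathcal W$, $\Theta\subseteq I$ special) and $\tau\mathcal W_J\in\mathcal C$. Unfortunately, this action does not preserve the order on $\mathcal C$. The parabolic submonoid $\widehat{\mathcal W}_J$ is the stabilizer of $\mathcal W_J\in\mathcal C$, $J\subseteq I$.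
   Context: $A=(a_{ij})_{i,j\in I}$ ($I$ finite) is a symmetrizable generalized Cartan matrix with a minimal realization over $\mathbb R$: a real vector space $\mathfrak h_{\mathbb R}$ of dimension $2|I|-\mathrm{rank}\,A$, linearly independent $(h_i)_{i\in I}$ in $\mathfrak h_{\mathbb R}$ and linearly independent $(\alpha_i)_{i\in I}$ in $\mathfrak h_{\mathbb R}^*$ with $\alpha_j(h_i)=a_{ij}$. The Weyl group $\mathcal W$ is the Coxeter group generated by the simple reflections $\sigma_i$ ($i\in I$), acting on $\mathfrak h_{\mathbb R}^*$ by $\sigma_i\lambda=\lambda-\lambda(h_i)\alpha_i$; $\mathcal W_J=\langle\sigma_j\mid j\in J\rangle$ for $J\subseteq I$. $J^\bot=\{i\in I\mid a_{ij}=0\ \forall j\in J\}$. $J^\infty$ is the union of the connected components of $J$ for which the corresponding submatrix of $A$ is not of finite type ($\emptyset^\infty=\emptyset$). $\Theta\subseteq I$ is special if $\Theta=\Theta^\infty$. The Tits cone is $X=\mathcal W\{\lambda\in\mathfrak h_{\mathbb R}^*\mid\lambda(h_i)\ge0\ \forall i\in I\}$; faces of $X$ are (nonempty) faces of the convex cone $X$ in the sense of convex geometry. For $\Theta$ special, $R(\Theta)=\{\lambda\in X\mid\lambda(h_i)=0\ \forall i\in\Theta\}$ is a face, and every face is $\sigma R(\Theta)$ with $\sigma\in\mathcal W$ and a unique special $\Theta$. **Face monoid $\widehat{\mathcal W}$.** On the set of pairs $(\sigma,R)$ ($\sigma\in\mathcal W$, $R$ a face of $X$) with product $(\sigma,R)(\tau,S)=(\sigma\tau,\tau^{-1}R\cap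 S)$ consider the congruence $(\sigma,R)\sim(\sigma',R')$ iff $R=R'$ and $\sigma^{-1}\sigma'$ fixes $R$ pointwise. $\widehat{\mathcal W}$ is the quotient monoid; $\sigma\varepsilon(R)$ is the class of $(\sigma,R)$, $\varepsilon(R)=1\varepsilon(R)$, and $\sigma\in\mathcal W$ is identified with $\sigma\varepsilon(X)$. Every element of $\widehat{\mathcal W}$ has the form $\sigma_1\varepsilon(R(\Theta))\sigma_2$ with $\sigma_1,\sigma_2\in\mathcal W$ and $\Theta$ special. $\widehat{\mathcal W}_J=\{\sigma\varepsilon(\tau R(\Theta))\mid\sigma,\tau\in\mathcal W_J,\ \Theta\subseteq J\text{ special}\}$ is the standard parabolic submonoid of type $J$. **Coxeter complex.** $\mathcal C=\{\sigma\mathcal W_J\mid\sigma\in\mathcal W,J\subseteq I\}$, ordered by reverse inclusion ($V\le V'$ iff $V\supseteq V'$). $\mathcal W_J\downarrow=\{V\in\mathcal C\mid V\le\mathcal W_J\}$, and $\mathcal W_{\Theta^\bot}(\mathcal W_\Theta\downarrow)=\{\sigma V\mid\sigma\in\mathcal W_{\Theta^\bot},V\in\mathcal W_\Theta\downarrow\}$.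
   Formalization: That the action does not preserve the order on the Coxeter complex is proved for every A having a special set Θ other than ∅ and I (and such an A is exhibited); without such a Θ, e.g. for A of finite type, the action does preserve the order. *)

(* Defs.v *)
From HB Require Import structures.
From mathcomp Require Import all_boot all_order all_algebra.
From mathcomp Require Import generic_quotient lra.
From mathcomp Require Import boolp classical_sets reals interval_inference convex.

Set Implicit Arguments.
Unset Strict Implicit.
Unset Printing Implicit Defensive.

Import Order.TTheory GRing.Theory Num.Theory.

Local Open Scope classical_set_scope.
Local Open Scope ring_scope.
Local Open Scope quotient_scope.

(* The finite index set I is ['I_n] throughout. *)

Definition gcm n (A : 'M[int]_n) : Prop :=
  [/\ forall i, A i i = 2,
      forall i j, i != j -> A i j <= 0 &
      forall i j, A i j = 0 -> A j i = 0].

Definition symmetrizable (R : realType) n (A : 'M[int]_n) : Prop :=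
  exists (d : 'rV[R]_n) (B : 'M[R]_n),
    [/\ forall i, d 0 i != 0, B^T = B & map_mx intr A = diag_mx d *m B].

(* Kac's definition of finite type for an indecomposable matrix (it is only
   used for these); vector inequalities are entrywise. *)
Definition finite_type (R : realType) m (B : 'M[int]_m) : Prop :=
  let M : 'M[R]_m := map_mx intr B in
  [/\ \det M != 0,
      exists2 u : 'cV[R]_m, (forall i, 0 < u i 0) & forall i, 0 < (M *m u) i 0 &
      forall v : 'cV[R]_m, (forall i, 0 <= (M *m v) i 0) ->
        (forall i, 0 < v i 0) \/ v = 0].

Definition principal_submx n (A : 'M[int]_n) (K : {set 'I_n}) : 'M[int]_#|K| :=
  \matrix_(i < #|K|, j < #|K|) A (enum_val i) (enum_val j).

(* Edges of the diagram of [A] with both ends in [J]. *)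
Definition diagram n (A : 'M[int]_n) (J : {set 'I_n}) : rel 'I_n :=
  [rel i j | [&& i \in J, j \in J, i != j & A i j != 0]].

Definition components n (A : 'M[int]_n) (J : {set 'I_n}) : {set {set 'I_n}} :=
  [set [set j in J | connect (diagram A J) i j]%SET | i in J]%SET.

Definition infpart (R : realType) n (A : 'M[int]_n) (J : {set 'I_n}) :
    {set 'I_n} :=
  (\bigcup_(K in components A J | ~~ `[< finite_type R (principal_submx A K) >])
     K)%SET.

Definition special (R : realType) n (A : 'M[int]_n) (Theta : {set 'I_n}) : Prop :=
  Theta = infpart R A Theta.

Definition perp n (A : 'M[int]_n) (J : {set 'I_n}) : {set 'I_n} :=
  [set i | [forall j in J, A i j == 0]]%SET.

(* Minimal realizations over [R] of the symmetrizable generalized Cartan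
   matrix [A]. *)
Record realization (R : realType) n (A : 'M[int]_n) := Realization {
  realization_gcm : gcm A;
  realization_symmetrizable : symmetrizable R A;
  cartan : vectType R;
  coroot : 'I_n -> cartan;
  simple_root : 'I_n -> 'Hom(cartan, R^o);
  cartan_dim : \dim {:cartan} = (2 * n - \rank (map_mx intr A : 'M[R]_n))%N;
  coroot_free : free [seq coroot i | i : 'I_n];
  simple_root_free : free [seq simple_root i | i : 'I_n];
  simple_rootE : forall i j, simple_root j (coroot i) = (A i j)%:~R
}.

Section WeylGroup.
Variables (R : realType) (n : nat) (A : 'M[int]_n) (D : realization R A).

Definition weight : vectType R := 'Hom(cartan D, R^o).

Definition reflection_fun (i : 'I_n) (l : weight) : weight :=
  l - (l (coroot D i) : R) *: simple_root D i.

Fact reflection_is_linear i : linear (reflection_fun i).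
Proof.
move=> a u v; rewrite /reflection_fun add_lfunE scale_lfunE.
rewrite scalerDl -scalerA scalerBr opprD.
by rewrite addrACA.
Qed.

HB.instance Definition _ i :=
  GRing.isLinear.Build R weight weight _ (reflection_fun i)
    (reflection_is_linear i).

Definition reflection (i : 'I_n) : 'End(weight) := linfun (reflection_fun i).

(* The subgroup of GL(weight) generated by the reflections indexed by [J]. *)
Inductive generated (J : {set 'I_n}) : 'End(weight) -> Prop :=
| generated_refl i : i \in J -> generated J (reflection i)
| generated_one : generated J \1%VF
| generated_mul f g : generated J f -> generated J g -> generated J (f \o g)%VF
| generated_inv f : generated J f -> generated J f^-1%VF.

Fact generated_lker0 J f : generated J f -> lker f == 0%VS.
Proof.
elim=> {f} [i _||f g _ kf _ kg|f _ kf].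
- apply/lker0P=> u v; rewrite !lfunE /= => euv.
  have ev : u (coroot D i) = v (coroot D i).
    have := congr1 (fun l : weight => l (coroot D i)) euv.
    rewrite /reflection_fun !add_lfunE !opp_lfunE !scale_lfunE simple_rootE.
    have [Aii _ _] := realization_gcm D; rewrite Aii => e.
    have scale2 (x : R) : x - x * 2%:~R = - x.
      by rewrite mulrC mulr_natl mulr2n opprD addNKr.
    have {}e : - (u (coroot D i) : R) = - (v (coroot D i) : R).
      by rewrite -[LHS]scale2 -[RHS]scale2; exact: e.
    by apply: oppr_inj.
  by move: euv; rewrite /reflection_fun ev; apply: addIr.
- by apply/lker0P; rewrite /= => u v; rewrite !id_lfunE.
- apply/lker0P=> u v; rewrite !comp_lfunE => /(lker0P kf); exact/lker0P.
- apply/lker0P=> u v e.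
  by rewrite -[u](lker0_lfunVK kf) e lker0_lfunVK.
Qed.

(* The Weyl group, realized as the group of linear automorphisms of [weight]
   generated by the simple reflections. *)
Definition weyl := {f : 'End(weight) | `[< generated [set: 'I_n]%SET f >]}.
HB.instance Definition _ := SubChoice.on weyl.


Definition weyl_fun (w : weyl) : 'End(weight) := val w.
Coercion weyl_fun : weyl >-> hom.
Definition mkweyl f (Wf : generated [set: 'I_n]%SET f) : weyl :=
  exist _ f (asboolT Wf).

Fact weylP (w : weyl) : generated [set: 'I_n]%SET (val w).
Proof. exact/asboolP/(valP w). Qed.

Definition weyl_one : weyl := mkweyl (generated_one _).
Definition weyl_mul (v w : weyl) : weyl :=
  mkweyl (generated_mul (weylP v) (weylP w)).
Definition weyl_inv (w : weyl) : weyl := mkweyl (generated_inv (weylP w)).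

Fact weyl_mulA : associative weyl_mul.
Proof. by move=> u v w; apply/val_inj/comp_lfunA. Qed.
Fact weyl_mul1 : left_id weyl_one weyl_mul.
Proof. by move=> w; apply/val_inj/comp_lfun1l. Qed.
Fact weyl_mulr1 : right_id weyl_one weyl_mul.
Proof. by move=> w; apply/val_inj/comp_lfun1r. Qed.
Fact weyl_mulV : left_inverse weyl_one weyl_inv weyl_mul.
Proof.
by move=> w; apply/val_inj/lker0_compVf/(generated_lker0 (weylP w)).
Qed.
Fact weyl_mulrV : right_inverse weyl_one weyl_inv weyl_mul.
Proof.
by move=> w; apply/val_inj/lker0_compfV/(generated_lker0 (weylP w)).
Qed.
HB.instance Definition _ :=
  isGroup.Build weyl weyl_mulA weyl_mul1 weyl_mulr1 weyl_mulV weyl_mulrV.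

Fact weyl1 l : weyl_fun 1%g l = l.
Proof. exact: id_lfunE. Qed.
Fact weylM (v w : weyl) l : weyl_fun (v * w)%g l = v (w l).
Proof. exact: comp_lfunE. Qed.

Definition parabolic (J : {set 'I_n}) : set weyl :=
  [set w | generated J (val w)].

End WeylGroup.
Arguments parabolic {R n A} D J.

Section TitsCone.
Variables (R : realType) (n : nat) (A : 'M[int]_n) (D : realization R A).
Notation W := (weyl D).

Definition dominant : set (weight D) :=
  [set l | forall i, 0 <= (l (coroot D i) : R)].

Definition tits_cone : set (weight D) :=
  [set l | exists w : W, exists2 m, dominant m & l = w m].

Definition is_face (F : set (weight D)) : Prop :=
  [/\ F `<=` tits_cone, F !=set0, convex_set F &
      forall x y (t : R), tits_cone x -> tits_cone y -> 0 < t < 1 ->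
        F (t *: x + (1 - t) *: y) -> F x /\ F y].

Definition face := {F : set (weight D) | `[< is_face F >]}.
HB.instance Definition _ := SubChoice.on face.

Definition mkface F (fF : is_face F) : face := exist _ F (asboolT fF).

Fact faceP (F : face) : is_face (val F).
Proof. exact/asboolP/(valP F). Qed.

Fact tits_cone_weyl (w : W) l : tits_cone l -> tits_cone (w l).
Proof.
move=> [v [m dm ->]]; exists (w * v)%g, m => //.
by rewrite weylM.
Qed.

Fact weylK (w : W) : cancel w (weyl_fun w^-1%g).
Proof. by move=> l; rewrite -weylM mulVg weyl1. Qed.

Fact weylVK (w : W) : cancel (weyl_fun w^-1%g) w.
Proof. by move=> l; rewrite -weylM mulgV weyl1. Qed.

Fact tits_coneZ (a : R) l : 0 <= a -> tits_cone l -> tits_cone (a *: l).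
Proof.
move=> a0 [w [m dm ->]]; exists w, (a *: m); last by rewrite linearZ.
by move=> i; rewrite scale_lfunE mulr_ge0.
Qed.

(* Faces contain 0, so that they are stable under intersection. *)
Fact face0 F : is_face F -> F 0.
Proof.
case=> FX [x Fx] _ FE.
have h0 : 0 < (2^-1 : R) < 1 by apply/andP; split; lra.
have Xx := FX _ Fx.
have X0 : tits_cone 0 by rewrite -(scale0r x); apply: tits_coneZ.
have X2 : tits_cone (2 *: x) by apply: tits_coneZ.
have [|//] := FE 0 (2 *: x) 2^-1 X0 X2 h0.
have -> : 1 - 2^-1 = 2^-1 :> R by lra.
have h2 : 2^-1 * 2 = 1 :> R by lra.
by rewrite scaler0 add0r scalerA h2 scale1r.
Qed.

Fact is_faceI F G : is_face F -> is_face G -> is_face (F `&` G).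
Proof.
move=> fF fG; have F0 := face0 fF; have G0 := face0 fG.
case: fF fG => FX _ Fc FE [GX _ Gc GE]; split.
- by move=> x [/FX].
- by exists 0.
- move=> x y t; rewrite !inE => -[Fx Gx] [Fy Gy]; split.
  + by have := Fc x y t; rewrite !inE; apply.
  + by have := Gc x y t; rewrite !inE; apply.
- move=> x y t Xx Xy t01 [/(FE _ _ _ Xx Xy t01)[? ?]].
  by move=> /(GE _ _ _ Xx Xy t01)[? ?].
Qed.

Fact is_face_translate (w : W) F : is_face F -> is_face (w @` F).
Proof.
case=> FX [x0 Fx0] Fc FE; split.
- by move=> _ [x /FX Xx <-]; apply: tits_cone_weyl.
- by exists (w x0), x0.
- move=> _ _ t /[!inE] -[x Fx <-] [y Fy <-].
  exists (t%:num *: x + (1 - t%:num) *: y)%R.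
    by have := Fc x y t; rewrite !inE; apply.
  by rewrite linearD !linearZ.
- move=> x y t Xx Xy t01 [z Fz ez].
  have Xwx := tits_cone_weyl w^-1%g Xx; have Xwy := tits_cone_weyl w^-1%g Xy.
  have [|Fx Fy] := FE _ _ _ Xwx Xwy t01.
    by rewrite -!linearZ -linearD -ez /= weylK.
  by split; [exists (weyl_fun w^-1%g x)|exists (weyl_fun w^-1%g y)]; rewrite ?weylVK.
Qed.

Definition faceI (F G : face) : face := mkface (is_faceI (faceP F) (faceP G)).
Definition face_translate (w : W) (F : face) : face :=
  mkface (is_face_translate w (faceP F)).

(* [std_face Theta] is R(Theta). *)
Definition std_face (Theta : {set 'I_n}) : set (weight D) :=
  [set l | tits_cone l /\ forall i, i \in Theta -> l (coroot D i) = 0].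

(* That X (whose convexity is a theorem) and the R(Theta) are faces is recorded
   as a proposition, rather than proved here: terms below that use X or R(Theta)
   as an element of [face D] take a proof of it. *)
Record std_faces : Prop := StdFaces {
  tits_coneP : is_face tits_cone;
  std_faceP : forall Theta, special R A Theta -> is_face (std_face Theta)
}.

End TitsCone.
Arguments tits_cone {R n A} D.
Arguments std_face {R n A} D Theta.

Section FaceMonoid.
Variables (R : realType) (n : nat) (A : 'M[int]_n) (D : realization R A).
Variable std : std_faces D.
Notation W := (weyl D).

Definition pair_eqv (p q : W * face D) : bool :=
  (p.2 == q.2) &&
  `[< forall l, val p.2 l -> weyl_fun (p.1^-1 * q.1)%g l = l >].

Fact pair_eqvP (p q : W * face D) :
  reflect
    (p.2 = q.2 /\ forall l, val p.2 l -> weyl_fun p.1 l = weyl_fun q.1 l)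
    (pair_eqv p q).
Proof.
apply: (iffP andP) => [[/eqP e /asboolP h]|[e h]]; split=> //.
- move=> l pl; have := h l pl.
  by rewrite weylM => /(congr1 (weyl_fun p.1)); rewrite weylVK.
- exact/eqP.
- by apply/asboolP=> l pl; rewrite weylM -h// weylK.
Qed.

Fact pair_eqv_refl : reflexive pair_eqv.
Proof. by move=> p; apply/pair_eqvP. Qed.
Fact pair_eqv_sym : symmetric pair_eqv.
Proof.
suff h p q : pair_eqv p q -> pair_eqv q p by move=> p q; apply/idP/idP; apply: h.
by case/pair_eqvP=> e h; apply/pair_eqvP; split=> // l; rewrite -e => /h.
Qed.
Fact pair_eqv_trans : transitive pair_eqv.
Proof.
move=> q p r /pair_eqvP[e h] /pair_eqvP[e' h']; apply/pair_eqvP; split.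
  by rewrite e.
by move=> l pl; rewrite h// h'// -e.
Qed.
Canonical pair_eqv_equiv :=
  EquivRel pair_eqv pair_eqv_refl pair_eqv_sym pair_eqv_trans.

Definition pair_mul (p q : W * face D) : W * face D :=
  ((p.1 * q.1)%g, faceI (face_translate q.1^-1%g p.2) q.2).

(* The argument of type [std_faces D] is used only in the unit [(1, X)]. *)
Definition face_monoid of std_faces D : Type := {eq_quot pair_eqv}.
Local Notation fm := (face_monoid std).
HB.instance Definition _ := Choice.on fm.

Definition fm_class (w : W) (F : face D) : fm := \pi_({eq_quot pair_eqv}) (w, F).

Fact fm_classP v w F G :
  fm_class v F = fm_class w G <-> pair_eqv (v, F) (w, G).
Proof. by split=> [/eqmodP|?]; last exact/eqmodP. Qed.

Definition fm_one : fm := fm_class 1%g (mkface (tits_coneP std)).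

Definition fm_mul (x y : fm) : fm :=
  let p := pair_mul (repr (x : {eq_quot pair_eqv}))
                    (repr (y : {eq_quot pair_eqv})) in fm_class p.1 p.2.

Fact fm_classK (x : fm) : exists p, x = fm_class p.1 p.2.
Proof.
exists (repr (x : {eq_quot pair_eqv})).
by rewrite /fm_class -surjective_pairing reprK.
Qed.

Fact face_translateE (w : W) (F : face D) l :
  val (face_translate w^-1%g F) l <-> val F (w l).
Proof.
split=> [[m Fm <-]|Fl]; first by rewrite weylVK.
by exists (w l) => //; rewrite weylK.
Qed.

Fact face_ext (F G : face D) : (forall l, val F l <-> val G l) -> F = G.
Proof. by move=> FG; apply/val_inj/seteqP; split=> l /FG. Qed.

Fact pair_mul_eqv p p' q q' : pair_eqv p p' -> pair_eqv q q' ->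
  pair_eqv (pair_mul p q) (pair_mul p' q').
Proof.
move=> /pair_eqvP[ep hp] /pair_eqvP[eq hq]; apply/pair_eqvP; split=> /=.
  apply: face_ext => l; rewrite /= -ep -eq; split=> -[+ ql];
    move/face_translateE => pl; split=> //; apply/face_translateE.
    by rewrite -hq.
  by rewrite hq.
move=> l [/face_translateE pl ql].
by rewrite !weylM -hq// hp.
Qed.

Fact fm_mulE v w F G :
  fm_mul (fm_class v F) (fm_class w G) =
    fm_class (v * w)%g (faceI (face_translate w^-1%g F) G).
Proof.
apply/fm_classP; rewrite -surjective_pairing.
apply: (@pair_mul_eqv _ (v, F) _ (w, G)).
  by apply/(@eqmodP _ pair_eqv_equiv); rewrite reprK.
by apply/(@eqmodP _ pair_eqv_equiv); rewrite reprK.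
Qed.

Fact fm_mulA : associative fm_mul.
Proof.
move=> x y z; have [[u F] ->] := fm_classK x; have [[v G] ->] := fm_classK y.
have [[w H] ->] := fm_classK z; rewrite !fm_mulE mulgA; congr fm_class.
apply: face_ext => l; split.
  move=> [/face_translateE Fl [/face_translateE Gl Hl]]; split=> //.
  apply/face_translateE; split=> //; apply/face_translateE.
  by move: Fl; rewrite weylM.
move=> [/face_translateE [/face_translateE Fl Gl] Hl]; split.
  by apply/face_translateE; rewrite weylM.
by split=> //; apply/face_translateE.
Qed.

Fact fm_mul1 : left_id fm_one fm_mul.
Proof.
move=> x; have [[w F] ->] := fm_classK x; rewrite fm_mulE mul1g.
congr fm_class; apply: face_ext => l; split=> [[]//|Fl]; split=> //.
apply/face_translateE/tits_cone_weyl.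
by have [FX _ _ _] := faceP F; apply: FX.
Qed.

Fact fm_mulr1 : right_id fm_one fm_mul.
Proof.
move=> x; have [[w F] ->] := fm_classK x; rewrite fm_mulE mulg1.
congr fm_class; apply: face_ext => l; split.
  by move=> [/face_translateE]; rewrite weyl1.
move=> Fl; split; first by apply/face_translateE; rewrite weyl1.
by have [FX _ _ _] := faceP F; apply: FX.
Qed.
HB.instance Definition _ := isMonoid.Build fm fm_mulA fm_mul1 fm_mulr1.

(* [fm_weyl w] is w eps(X), identified with w; [fm_idem F] is eps(F). *)
Definition fm_weyl (w : W) : fm := fm_class w (mkface (tits_coneP std)).

Definition fm_idem (F : face D) : fm := fm_class 1%g F.

Definition stdF Theta (sTheta : special R A Theta) : face D :=
  mkface (std_faceP std sTheta).

Definition parabolic_submonoid (J : {set 'I_n}) : set fm :=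
  [set x | exists v w : W, exists Theta (sTheta : special R A Theta),
    [/\ parabolic D J v, parabolic D J w, Theta \subset J &
        x = fm_class v (face_translate w (stdF sTheta))]].

End FaceMonoid.
Arguments fm_class {R n A D} std w F.
Arguments fm_weyl {R n A D} std w.
Arguments fm_idem {R n A D} std F.
Arguments parabolic_submonoid {R n A D} std J.

Section CoxeterComplex.
Variables (R : realType) (n : nat) (A : 'M[int]_n) (D : realization R A).
Notation W := (weyl D).

Definition coset (w : W) (J : {set 'I_n}) : set W :=
  [set (w * u)%g | u in parabolic D J].

Definition is_coset (V : set W) : Prop := exists w J, V = coset w J.

Definition coxeter_complex := {V : set W | is_coset V}.
Definition cc_set (V : coxeter_complex) : set W := sval V.
Coercion cc_set : coxeter_complex >-> set.

Fact coset_is_coset w J : is_coset (coset w J).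
Proof. by exists w, J. Qed.

Definition cc_coset w J : coxeter_complex := exist _ _ (coset_is_coset w J).

Definition cc_std (J : {set 'I_n}) : coxeter_complex := cc_coset 1%g J.

Definition cc_le (V V' : coxeter_complex) : Prop := (V' : set W) `<=` V.

Definition cc_down (J : {set 'I_n}) : set coxeter_complex :=
  [set V | cc_le V (cc_std J)].

Definition bad_domain (Theta : {set 'I_n}) : set coxeter_complex :=
  [set V | exists w, exists U : coxeter_complex,
     [/\ parabolic D (perp A Theta) w, cc_down Theta U &
         (V : set W) = [set (w * u)%g | u in (U : set W)]]].

End CoxeterComplex.
Arguments cc_std {R n A} D J.

Section Actions.
Variables (R : realType) (n : nat) (A : 'M[int]_n) (D : realization R A).
Variable std : std_faces D.
Notation W := (weyl D).
Notation C := (coxeter_complex D).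
Variable act : face_monoid std -> C -> C.

Definition is_monoid_action : Prop :=
  (forall V, act 1%g V = V) /\
  (forall x y V, act (x * y)%g V = act x (act y V)).

Definition is_faithful : Prop :=
  forall x y, (forall V, act x V = act y V) -> x = y.

Definition is_order_preserving : Prop :=
  forall x V V', cc_le V V' -> cc_le (act x V) (act x V').

Definition stabilizer (V : C) : set (face_monoid std) := [set x | act x V = V].

(* The formula must hold for all expressions s1 eps(R(Theta)) s2 and t W_J, so
   that existence of such an [act] includes its being well defined. *)
Definition is_bad_action : Prop :=
  forall (s1 s2 : W) Theta (sTheta : special R A Theta) (t : W) (J : {set 'I_n}),
    act (fm_weyl std s1 * fm_idem std (stdF std sTheta) * fm_weyl std s2)%g
        (cc_coset t J) =
      if `[< bad_domain Theta (cc_coset (s2 * t)%g J) >]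
      then cc_coset (s1 * s2 * t)%g J else cc_std D [set: 'I_n]%SET.

End Actions.

(* Main.v *)
Require Import Defs.
From HB Require Import structures.
From mathcomp Require Import all_boot all_order all_algebra.
From mathcomp Require Import ring lra zify.
From mathcomp Require Import boolp classical_sets reals interval_inference convex.

Set Implicit Arguments.
Unset Strict Implicit.
Unset Printing Implicit Defensive.

Import Order.TTheory GRing.Theory Num.Theory.

(** The formula of the bad action becomes transparent on the geometric side.
A coset [t W_J] stands for the facet [t F_J] of the Tits cone [X], where [F_J]
is the set of dominant weights whose zero set (the [i] with [l(h_i) = 0]) is
exactly [J]; the reverse inclusion of cosets is the inclusion of facets into
closures of facets, and [W_I] is the smallest facet.  The coset [t W_J] lies in
[W_(Theta^perp) (W_Theta down)] if and only if the facet [t F_J] is contained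
in the face [R(Theta)] ([bad_domainE]).  Hence the formula says that
[sigma eps(R)] moves a facet by [sigma] if the facet is contained in [R], and
sends it to the smallest facet otherwise.  In this form the action is defined
for every face [R], compatibility with the product is immediate, and
faithfulness holds because a face is a union of facets: the facets contained
in [R] determine [R], and the images of their points determine [sigma] on [R].
The order is not preserved, since for [Theta] special the element
[eps(R(Theta))] fixes [W_Theta] but sends the larger element [{1}] of the
complex to [W_I].

Three facts carry this translation.

- The dominant cone is a strict fundamental domain: if [l] and [w l] are
  dominant then [w l = l] and [w] belongs to [W_J] for [J] the zero set of [l]
  ([fundamental_domain]).  This, the convexity of [X], and the possibility to
  make a point of [X] nonnegative on any [J] by an element of [W_J], all follow
  from one property of the length function: if the left multiplication by
  [sigma_i] does not shorten [w], then [w] sends dominant weights to weights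
  that are nonnegative on [h_i] ([tits_lemma]).  The latter is reduced to rank
  two, where it is a computation.

- [R(Theta)] is a face, and it is the union of the [W_(Theta^perp)]-translates
  of its dominant part.  A component of [Theta] that is not of finite type
  carries a positive combination [delta] of its coroots on which every simple
  root is nonpositive ([nonfinite_type_vector], a consequence of linear
  duality); such a [delta] is nonnegative on [X], and vanishes on [R(Theta)].

- Every face [F] that contains [F_J] is [v R(Theta)] with [v] in [W_J] and
  [Theta] a special subset of [J] ([face_std]); this computes the stabilizers.
  Among the facets [v F_K] in [F] with [v] in [W_J] and [K] a subset of [J], a
  largest one has [K] without components of finite type: a component of finite
  type could be removed from [K], because the Tits cone contains points with
  arbitrary integral values on it ([finite_type_dominantize]).  Then
  [F = v R(K)] by convexity. *)

(** * Simple reflections, words and length *)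

Section Weyl.
Local Open Scope ring_scope.
Variables (R : realType) (n : nat) (A : 'M[int]_n) (D : realization R A).
Implicit Types (i j k : 'I_n) (J K : {set 'I_n}) (u v w : weyl D).
Implicit Types (l m : weight D).

Definition pairing l i : R := l (coroot D i).

Lemma pairingD l m i : pairing (l + m) i = pairing l i + pairing m i.
Proof. by rewrite /pairing add_lfunE. Qed.

Lemma pairingZ (a : R) l i : pairing (a *: l) i = a * pairing l i.
Proof. by rewrite /pairing scale_lfunE. Qed.

Lemma pairingB l m i : pairing (l - m) i = pairing l i - pairing m i.
Proof. by rewrite -scaleN1r pairingD pairingZ mulN1r. Qed.

Lemma pairing_root i j : pairing (simple_root D j) i = (A i j)%:~R.
Proof. exact: simple_rootE. Qed.

Lemma A_diag i : A i i = 2.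
Proof. by case: (realization_gcm D). Qed.

Lemma A_offdiag i j : i != j -> A i j <= 0.
Proof. by case: (realization_gcm D) => _ + _; apply. Qed.

Lemma A_zero i j : A i j = 0 -> A j i = 0.
Proof. by case: (realization_gcm D) => _ _; apply. Qed.

(** The coroots are linearly independent, so the values on them are free. *)
Lemma exists_weight (f : 'I_n -> R) : exists l, forall i, pairing l i = f i.
Proof.
pose X := [tuple of [seq coroot D i | i : 'I_n]].
have frX : free X by exact: coroot_free.
pose o i : 'I_#|'I_n| := cast_ord (esym (card_ord n)) i.
pose g (h : cartan D) : R^o := \sum_(i : 'I_n) f i * coord X (o i) h.
have g_lin : linear g.
  move=> a h1 h2; rewrite /g scaler_sumr -big_split; apply: eq_bigr => i _ /=.
  by rewrite linearP mulrDr; congr (_ + _); apply: mulrCA.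
pose gL := GRing.isLinear.Build R (cartan D) R^o _ g g_lin.
pose G : {linear cartan D -> R^o} := HB.pack g gL.
exists (linfun G) => i; rewrite /pairing lfunE /= /g.
have Xi : X`_i = coroot D i.
  by rewrite (nth_map i) ?size_enum_ord ?ltn_ord // nth_ord_enum.
have oE j : coord X (o j) (coroot D i) = (j == i)%:R.
  rewrite -Xi; have := @coord_free _ _ _ X (o i) (o j) frX.
  by rewrite /= => ->; rewrite -(inj_eq val_inj) /= val_eqE eq_sym.
rewrite (bigD1 i) //= big1 => [|j ji]; rewrite oE; last by rewrite (negPf ji) mulr0.
by rewrite eqxx mulr1 addr0.
Qed.

Lemma weyl_ext v w : (forall l, v l = w l) -> v = w.
Proof. by move=> vw; apply/val_inj/lfunP. Qed.

Definition simple i : weyl D := mkweyl (generated_refl D (finset.in_setT i)).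

Lemma simpleE i l : simple i l = l - pairing l i *: simple_root D i.
Proof. by rewrite /simple /weyl_fun /= lfunE. Qed.

Lemma pairing_simple i l k :
  pairing (simple i l) k = pairing l k - pairing l i * (A k i)%:~R.
Proof. by rewrite simpleE pairingB pairingZ pairing_root. Qed.

Lemma pairing_simple_diag i l : pairing (simple i l) i = - pairing l i.
Proof. by rewrite pairing_simple A_diag; lra. Qed.

Lemma simpleK i l : simple i (simple i l) = l.
Proof.
by rewrite [LHS]simpleE pairing_simple_diag simpleE scaleNr opprK subrK.
Qed.

Lemma simple2 i : (simple i * simple i = 1)%g.
Proof. by apply: weyl_ext => l; rewrite weylM simpleK weyl1. Qed.

Lemma simpleV i : ((simple i)^-1 = simple i)%g.
Proof. by rewrite -[LHS]mulg1 -(simple2 i) mulKg. Qed.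

Lemma simpleMK i w : (simple i * (simple i * w) = w)%g.
Proof. by rewrite mulgA simple2 mul1g. Qed.

Lemma simple_fix i l : pairing l i = 0 -> simple i l = l.
Proof. by move=> li; rewrite simpleE li scale0r subr0. Qed.

Definition wprod (t : seq 'I_n) : weyl D :=
  foldr (fun i w => simple i * w)%g 1%g t.

Lemma wprod_cat s t : wprod (s ++ t) = (wprod s * wprod t)%g.
Proof. by elim: s => [|i s IH] /=; rewrite ?mul1g // IH mulgA. Qed.

Lemma wprod_rev t : ((wprod t)^-1 = wprod (rev t))%g.
Proof.
elim: t => [|i t IH] /=; first by rewrite invg1.
by rewrite invgM IH rev_cons -cats1 wprod_cat /= mulg1 simpleV.
Qed.

Lemma parabolicP J w :
  parabolic D J w <-> exists2 t, all (mem J) t & w = wprod t.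
Proof.
split.
- suff h f : generated J f -> exists2 t, all (mem J) t & f = val (wprod t).
    by move=> /h[t Jt e]; exists t => //; apply: val_inj.
  elim=> {f} [i Ji||f g _ [s Js ->] _ [t Jt ->]|f _ [t Jt ->]].
  + exists [:: i]; first by rewrite /= andbT.
    by have -> : wprod [:: i] = simple i by rewrite /wprod /= mulg1.
  + by exists [::].
  + by exists (s ++ t); rewrite ?all_cat ?Js // wprod_cat.
  + by exists (rev t); rewrite ?all_rev // -wprod_rev.
- case=> t Jt ->; elim: t Jt => [_|i t IH /= /andP[Ji /IH Jt]].
    exact: generated_one.
  exact: generated_mul (generated_refl D Ji) Jt.
Qed.

Lemma parabolic1 J : parabolic D J 1%g.
Proof. exact: generated_one. Qed.

Lemma parabolicM J v w :
  parabolic D J v -> parabolic D J w -> parabolic D J (v * w)%g.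
Proof. exact: generated_mul. Qed.

Lemma parabolicV J w : parabolic D J w -> parabolic D J (w^-1)%g.
Proof. exact: generated_inv. Qed.

Lemma parabolic_simple J i : i \in J -> parabolic D J (simple i).
Proof. by move=> Ji; apply: (generated_refl D Ji). Qed.

Lemma parabolicS J K w : J \subset K -> parabolic D J w -> parabolic D K w.
Proof.
move=> /fintype.subsetP JK /parabolicP[t /allP Jt ->]; apply/parabolicP.
by exists t => //; apply/allP=> i /Jt/JK.
Qed.

Lemma parabolicT w : parabolic D [set: 'I_n]%SET w.
Proof. exact: weylP. Qed.

Lemma parabolic_ind J (P : weight D -> Prop) w l :
  parabolic D J w -> (forall i m, i \in J -> P m -> P (simple i m)) ->
  P l -> P (w l).
Proof.
move=> /parabolicP[t + ->] IP Pl; elim: t => [_|i t IH /= /andP[Ji /IH Pt]].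
  by rewrite weyl1.
by rewrite weylM; apply: IP.
Qed.

Lemma parabolic_fix J w l :
  parabolic D J w -> (forall i, i \in J -> pairing l i = 0) -> w l = l.
Proof.
move=> Jw l0; apply: (@parabolic_ind J (fun m => m = l)) => // i _ Ji ->.
by rewrite simple_fix // l0.
Qed.

Lemma pairing_parabolic_perp J w l k :
  parabolic D J w -> (forall i, i \in J -> A k i = 0) ->
  pairing (w l) k = pairing l k.
Proof.
move=> Jw A0.
apply: (@parabolic_ind J (fun m => pairing m k = pairing l k)) => //.
by move=> i m Ji <-; rewrite pairing_simple A0 // mulr0 subr0.
Qed.

Lemma exists_word w : exists N : nat, `[< exists2 t, size t = N & w = wprod t >].
Proof.
have /parabolicP[t _ ->] := parabolicT w.
by exists (size t); apply/asboolP; exists t.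
Qed.

Definition len w : nat := ex_minn (exists_word w).

Lemma len_word w : exists2 t, size t = len w & w = wprod t.
Proof. by rewrite /len; case: ex_minnP => k /asboolP. Qed.

Lemma len_wprod t : (len (wprod t) <= size t)%N.
Proof.
rewrite /len; case: ex_minnP => k _; apply; apply/asboolP; by exists t.
Qed.

Lemma lenM v w : (len (v * w)%g <= len v + len w)%N.
Proof.
have [s <- ->] := len_word v; have [t <- ->] := len_word w.
by rewrite -wprod_cat -size_cat len_wprod.
Qed.

Lemma len_simple i w : (len (simple i * w)%g <= (len w).+1)%N.
Proof.
have [t <- ->] := len_word w.
by have := len_wprod (i :: t).
Qed.

Lemma len_descent w : w <> 1%g -> exists i, (len (simple i * w)%g < len w)%N.
Proof.
have [[|i t] /= <- ->] := len_word w; first by [].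
by move=> _; exists i; rewrite simpleMK ltnS len_wprod.
Qed.

End Weyl.

(** * Reduced words and positivity on coroots *)

Section TitsLemma.
Local Open Scope ring_scope.
Variables (R : realType) (n : nat) (A : 'M[int]_n) (D : realization R A).
Implicit Types (i j k : 'I_n) (J K : {set 'I_n}) (u v w : weyl D).
Implicit Types (l m : weight D).

Fixpoint alt i j (N : nat) : seq 'I_n :=
  if N is N'.+1 then i :: alt j i N' else [::].

Lemma size_alt i j N : size (alt i j N) = N.
Proof. by elim: N i j => //= N IH i j; rewrite IH. Qed.

Lemma alt_split i j (M N : nat) :
  (M <= N)%N -> exists2 r, size r = (N - M)%N & alt i j N = alt i j M ++ r.
Proof.
elim: M N i j => [|M IH] [|N] i j //= MN.
- by exists [::].
- by exists (i :: alt j i N); rewrite //= size_alt.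
- by have [r sr ->] := IH N j i MN; exists r.
Qed.

(** In rank two with [A i j * A j i >= 4] the dihedral group is infinite and an
alternating word of any length must preserve positivity.  The reflection
[i] maps the cone in the conclusion into the cone obtained by exchanging [i] and
[j], and both cones contain the dominant quadrant. *)
Lemma alt_cone i j N m :
  i != j -> 4 <= A i j * A j i -> 0 <= pairing m i -> 0 <= pairing m j ->
  0 <= pairing (wprod D (alt j i N) m) i /\
  0 <= - (A j i)%:~R * pairing (wprod D (alt j i N) m) i
       + 2 * pairing (wprod D (alt j i N) m) j.
Proof.
move=> ij c4 mi mj; elim: N i j ij c4 mi mj => [|N IH] i j ij c4 mi mj.
  rewrite /= weyl1; split=> //.
  have : (A j i)%:~R <= 0 :> R by rewrite lerz0 (A_offdiag D) // eq_sym.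
  by move=> ?; nra.
have [||mj1 mi1] := IH j i _ _ mj mi; [by rewrite eq_sym|by rewrite mulrC|].
rewrite /= !weylM !pairing_simple_diag !pairing_simple.
set p := pairing _ i in mi1 *; set q := pairing _ j in mj1 mi1 *.
have a0 : (A i j)%:~R <= 0 :> R by rewrite lerz0 (A_offdiag D).
have b0 : (A j i)%:~R <= 0 :> R by rewrite lerz0 (A_offdiag D) // eq_sym.
have {}c4 : 4 <= (A i j)%:~R * (A j i)%:~R :> R.
  by rewrite -intrM (ler_int R 4%:Z).
move: c4 a0 b0 mj1 mi1; move: ((A i j)%:~R : R) ((A j i)%:~R : R) => a b.
move=> c4 a0 b0 q0 pq; split; first by nra.
have : 0 <= - b * (- a * q + 2 * p) by rewrite mulr_ge0 // oppr_ge0.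
by nra.
Qed.

(** The orbit of [l] under the group generated by two reflections stays in the
affine plane through [l] spanned by the two roots, so that the braid relations
can be checked on two coordinates. *)
Definition plane i j l (x y : R) : weight D :=
  l - x *: simple_root D i - y *: simple_root D j.

Lemma plane0 i j l : plane i j l 0 0 = l.
Proof. by rewrite /plane !scale0r !subr0. Qed.

Lemma pairing_plane i j k l x y :
  pairing (plane i j l x y) k =
  pairing l k - x * (A k i)%:~R - y * (A k j)%:~R.
Proof. by rewrite /plane !pairingB !pairingZ !pairing_root. Qed.

Lemma simple_plane_l i j l x y :
  simple D i (plane i j l x y) =
  plane i j l (pairing l i - x - y * (A i j)%:~R) y.
Proof.
have e (p a : R) : x + (p - x * 2%:~R - y * a) = p - x - y * a.
  by rewrite (_ : 2%:~R = 2 :> R) //; ring.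
by rewrite simpleE pairing_plane (A_diag D) /plane addrAC -[l - _ - _]addrA
  -opprD -scalerDl e.
Qed.

Lemma simple_plane_r i j l x y :
  simple D j (plane i j l x y) =
  plane i j l x (pairing l j - y - x * (A j i)%:~R).
Proof.
have e (p a : R) : y + (p - x * a - y * 2%:~R) = p - y - x * a.
  by rewrite (_ : 2%:~R = 2 :> R) //; ring.
by rewrite simpleE pairing_plane (A_diag D) /plane -[l - _ - _ - _]addrA
  -opprD -scalerDl e.
Qed.

(** If the two alternating words of length [M] agree, a word starting with [j]
of length at least [M] can be rewritten to start with [i], so that the
multiplication by [i] shortens it. *)
Lemma braid_bound i j (M N : nat) :
  (0 < M)%N -> wprod D (alt i j M) = wprod D (alt j i M) ->
  (N <= len (simple D i * wprod D (alt j i N))%g)%N -> (N < M)%N.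
Proof.
case: M => // M _ br; rewrite ltnNge => h; apply/negP => MN; move: h.
have [r sr ->] := @alt_split j i M.+1 N MN.
rewrite wprod_cat -br /= -mulgA simpleMK -wprod_cat.
move=> /leq_trans/(_ (len_wprod _ _)).
rewrite size_cat size_alt sr; lia.
Qed.

Lemma cartan_integers (a b : int) :
  a <= 0 -> b <= 0 -> (a = 0 -> b = 0) -> (b = 0 -> a = 0) -> a * b < 4 ->
  [\/ [/\ a = 0 & b = 0], [/\ a = -1 & b = -1], [/\ a = -1 & b = -2]
    | [\/ [/\ a = -2 & b = -1], [/\ a = -1 & b = -3] | [/\ a = -3 & b = -1]]].
Proof.
move=> a0 b0 ab ba c.
have [ea|an0] := eqVneq a 0; first by constructor 1; rewrite ea ab.
have {}b0 : b <= -1 by have [/ba/eqP|] := eqVneq b 0; lia.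
have {}a0 : a <= -1 by lia.
have a3 : -3 <= a by nia.
have b3 : -3 <= b by nia.
have : a = -1 \/ a = -2 \/ a = -3 by lia.
case=> [e|[e|e]]; subst a.
- have [->|[->|->]] : b = -1 \/ b = -2 \/ b = -3 by lia.
  + by constructor 2.
  + by constructor 3.
  + by constructor 4; constructor 2.
- by constructor 4; constructor 1; split=> //; lia.
- by constructor 4; constructor 3; split=> //; lia.
Qed.

Lemma rank2_pos i j N m :
  i != j -> 0 <= pairing m i -> 0 <= pairing m j ->
  (N <= len (simple D i * wprod D (alt j i N))%g)%N ->
  0 <= pairing (wprod D (alt j i N) m) i.
Proof.
move=> ij mi mj.
have [c4|c4] := lerP 4 (A i j * A j i); first by case: (@alt_cone i j N m).
have aij := A_offdiag D ij; have ji : j != i by rewrite eq_sym.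
have aji := A_offdiag D ji.
have br M : (0 < M)%N ->
    (forall l, wprod D (alt i j M) (plane i j l 0 0) =
               wprod D (alt j i M) (plane i j l 0 0)) ->
    (N <= len (simple D i * wprod D (alt j i N))%g)%N -> (N < M)%N.
  move=> M0 h; apply: (braid_bound M0); apply: weyl_ext => l.
  by rewrite -[l](plane0 i j) h.
have dih := cartan_integers aij aji (@A_zero _ _ _ D i j) (@A_zero _ _ _ D j i) c4.
(* the order of the product of the two reflections: 2, 3, 4 or 6 *)
pose M := if A i j == 0 then 2%N else
  if A i j * A j i == 1 then 3%N else if A i j * A j i == 2 then 4%N else 6%N.
move=> /(br M) NM; have {br} NM : (N < M)%N.
{ apply: NM; first by rewrite /M; do 3 case: ifP => //.
  rewrite {}/M => l.
  case: dih => [[eij eji]|[eij eji]|[eij eji]|[[eij eji]|[eij eji]|[eij eji]]].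
  all: rewrite eij eji /= !weylM !weyl1 !(simple_plane_l, simple_plane_r).
  all: by rewrite eij eji; congr plane; ring. }
rewrite -[m](plane0 i j).
case: dih NM => [[eij eji]|[eij eji]|[eij eji]|[[eij eji]|[eij eji]|[eij eji]]].
all: rewrite {}/M eij eji /=; case: N => [|[|[|[|[|[|N]]]]]] // _ /=.
all: rewrite ?weylM weyl1 ?(simple_plane_l, simple_plane_r).
all: rewrite pairing_plane (A_diag D) ?eij ?eji; move: mi mj.
all: move: (pairing m i) (pairing m j) => p q p0 q0; lra.
Qed.

Lemma reduced_alt i j s : all (pred2 i j) s -> (size s <= len (wprod D s))%N ->
  ohead s != Some i -> s = alt j i (size s).
Proof.
elim: s i j => // x s IH i j /= /andP[xij sij] red xi.
have {xij} ex : x = j.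
  by case/orP: xij => /eqP // e; rewrite e eqxx in xi.
subst x; congr (_ :: _); apply: IH.
- by apply: sub_all sij => y /=; rewrite orbC.
- by rewrite -ltnS (leq_trans red) // len_simple.
- case: s red {sij} => //= y s red; apply/eqP=> -[e]; subst y.
  rewrite simpleMK in red.
  by have := leq_trans red (len_wprod D s); rewrite ltnNge leqnSn.
Qed.

(** If [w <> 1] some [j] shortens [w].  Write [w = u v] with [u] a word in [i]
and [j], lengths adding up, and [v] as short as possible.  Then neither [i] nor
[j] shortens [v], which is shorter than [w], so by induction [v l] is
nonnegative on [h_i] and [h_j].  The word [u] is reduced and does not begin with
[i], hence it alternates, and the claim becomes the rank two statement. *)
Theorem tits_lemma w i l :
  (len w <= len (simple D i * w)%g)%N -> dominant l -> 0 <= pairing (w l) i.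
Proof.
move=> + dl; have [N] := ubnP (len w); elim: N w i => // N IH w i wN wi.
have [->|/len_descent[j wj]] := pselect (w = 1%g); first by rewrite weyl1; apply: dl.
have ij : i != j by apply/eqP=> e; move: wi; rewrite e leqNgt wj.
(* [M] is the length of the right factor [v], to be minimized *)
pose P (M : nat) := `[< exists s v, [/\ all (pred2 i j) s,
   w = (wprod D s * v)%g, (size s + len v)%N = len w & len v = M] >].
have Pj : P (len (simple D j * w)%g).
  apply/asboolP; exists [:: j], (simple D j * w)%g; split=> //=.
  - by rewrite eqxx orbT.
  - by rewrite mulg1 simpleMK.
  - have := len_simple j (simple D j * w)%g; rewrite simpleMK => h.
    by rewrite add1n; apply/eqP; rewrite eqn_leq wj h.
case: (ex_minnP (ex_intro P _ Pj)) => M /asboolP[s [v [sij ew lw <-]]] minv.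
have lv : (len v < len w)%N by apply: leq_ltn_trans wj; apply: minv.
have vmin k : pred2 i j k -> (len v <= len (simple D k * v)%g)%N.
  move=> kij; rewrite leqNgt; apply/negP => kv.
  have ew' : w = (wprod D (rcons s k) * (simple D k * v))%g.
    by rewrite -cats1 wprod_cat /= mulg1 -mulgA simpleMK.
  suff /minv : P (len (simple D k * v)%g) by rewrite leqNgt kv.
  apply/asboolP; exists (rcons s k), (simple D k * v)%g; split=> //.
    by rewrite all_rcons sij andbT.
  have h1 := lenM (wprod D (rcons s k)) (simple D k * v)%g.
  have h2 := len_wprod D (rcons s k).
  by rewrite -ew' in h1; rewrite size_rcons in h2 *; lia.
have vi : 0 <= pairing (v l) i.
  by apply: (IH v i _ (vmin i _)); rewrite /= ?eqxx //; lia.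
have vj : 0 <= pairing (v l) j.
  by apply: (IH v j _ (vmin j _)); rewrite /= ?eqxx ?orbT //; lia.
have es : s = alt j i (size s).
  apply: reduced_alt => //.
    by have := lenM (wprod D s) v; rewrite -ew; lia.
  case: s ew lw {sij} => //= k s ew lw; apply/eqP=> -[e]; subst k.
  move: wi; have -> : (simple D i * w = wprod D s * v)%g.
    by rewrite ew /= -mulgA simpleMK.
  by have := lenM (wprod D s) v; have := len_wprod D s; lia.
rewrite ew weylM es; apply: rank2_pos => //; rewrite -es.
have := lenM (simple D i * wprod D s)%g v; rewrite -mulgA -ew => h.
by rewrite -(leq_add2r (len v)) lw (leq_trans wi h).
Qed.
End TitsLemma.

(** * The Tits cone *)

Section TitsConeGeometry.
Local Open Scope ring_scope.
Variables (R : realType) (n : nat) (A : 'M[int]_n) (D : realization R A).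
Implicit Types (i j k : 'I_n) (J K : {set 'I_n}) (u v w : weyl D).
Implicit Types (l m x y z : weight D).

Lemma dominant_tits_cone l : dominant l -> tits_cone D l.
Proof. by exists 1%g, l; rewrite ?weyl1. Qed.

(** Write [x = w m] with [m] dominant and choose [v] in [W_J] with [v w] of
minimal length: no simple reflection in [J] shortens [v w]. *)
Lemma tits_cone_dominantize J x : tits_cone D x ->
  exists2 v, parabolic D J v & forall j, j \in J -> 0 <= pairing (v x) j.
Proof.
move=> [w [m dm ->]].
pose P (N : nat) := `[< exists2 v, parabolic D J v & len (v * w)%g = N >].
have P1 : P (len w).
  by apply/asboolP; exists 1%g; rewrite ?mul1g //; apply: parabolic1.
case: (ex_minnP (ex_intro P _ P1)) => N /asboolP[v Jv <-] minv {P1}.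
exists v => // j Jj; rewrite -weylM; apply: tits_lemma => //; apply: minv.
apply/asboolP; exists (simple D j * v)%g; last by rewrite mulgA.
by apply: parabolicM => //; apply: parabolic_simple.
Qed.

Lemma len_simple_lt w l i :
  dominant l -> pairing (w l) i < 0 -> (len (simple D i * w)%g < len w)%N.
Proof.
move=> dl; rewrite !ltNge; apply: contraNltn; exact: (fun h => tits_lemma h dl).
Qed.

(** Induction on the length of [w].  If a point [z] of the segment from [y] to
[x = w l] is not dominant, the segment leaves the dominant cone at a point [y']
on some wall [i], beyond which the values on [h_i] are negative.  The reflection
[i] fixes [y'] and shortens [w], so it maps the rest of the segment into [X] by
the induction hypothesis. *)
Lemma tits_cone_segment w l y (t : R) : dominant l -> dominant y ->
  0 <= t <= 1 -> tits_cone D (t *: w l + (1 - t) *: y).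
Proof.
move=> dl; have [N] := ubnP (len w); elim: N w y t => // N IH w y t wN dy t01.
set x := w l; set z := t *: x + (1 - t) *: y.
have [dz|/existsNP[k0 /negP]] := pselect (dominant z).
  exact: dominant_tits_cone.
rewrite -/(pairing z k0) -ltNge => zk0.
have dyk k : 0 <= pairing y k by exact: dy.
have zE k : pairing z k = t * pairing x k + (1 - t) * pairing y k.
  by rewrite /z pairingD !pairingZ.
have t0 : 0 <= t by case/andP: t01.
have t1 : t <= 1 by case/andP: t01.
have xk0 : pairing x k0 < 0.
  by move: zk0; rewrite zE; have := dyk k0; nra.
(* the parameter at which the segment crosses the wall [k] *)
pose r k := pairing y k / (pairing y k - pairing x k).
have rE k : pairing x k < 0 -> r k * (pairing y k - pairing x k) = pairing y k.
  by move=> xk; rewrite divfK // lt0r_neq0 //; have := dyk k; lra.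
have [i xi rmin] : exists2 i, pairing x i < 0 &
    forall k, pairing x k < 0 -> r i <= r k.
  by case: (@arg_minP _ R _ k0 (fun k => pairing x k < 0) r) => // i; exists i.
have rk0 : r k0 < t.
  by move: zk0; rewrite zE; have := rE _ xk0; have := dyk k0; nra.
have ri0 : 0 <= r i by rewrite divr_ge0 //; have := dyk i; lra.
have ri1 : r i < t by apply: le_lt_trans rk0; apply: rmin.
pose y' := r i *: x + (1 - r i) *: y.
have y'E k : pairing y' k = r i * pairing x k + (1 - r i) * pairing y k.
  by rewrite /y' pairingD !pairingZ.
have dy' : dominant y'.
  move=> k; rewrite -/(pairing y' k) y'E; have := dyk k.
  have [xk|xk] := leP 0 (pairing x k); first by nra.
  by have := rmin _ xk; have := rE _ xk; nra.
have y'i : simple D i y' = y'.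
  by rewrite simple_fix // y'E; have := rE _ xi; lra.
pose s := (t - r i) / (1 - r i).
have r1 : 1 - r i != 0 by rewrite lt0r_neq0 //; lra.
have s01 : 0 <= s <= 1.
  by rewrite divr_ge0 ?ler_pdivrMr /=; lra.
have ez : z = s *: x + (1 - s) *: y'.
  have e1 : s + (1 - s) * r i = t by rewrite /s; field.
  have e2 : (1 - s) * (1 - r i) = 1 - t by rewrite /s; field.
  by rewrite /y' scalerDr !scalerA addrA -scalerDl e1 e2.
rewrite ez -[s *: x + _](simpleK i); apply: tits_cone_weyl.
rewrite linearD !linearZ /= y'i /x -weylM; apply: IH => //.
exact: leq_trans (len_simple_lt dl xi) _.
Qed.

Lemma tits_cone_convex x y (t : R) : tits_cone D x -> tits_cone D y ->
  0 <= t <= 1 -> tits_cone D (t *: x + (1 - t) *: y).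
Proof.
move=> [v [l dl ->]] [w [m dm ->]] t01.
rewrite -[_ *: v l + _](weylVK w); apply: tits_cone_weyl.
rewrite linearD !linearZ /= weylK -weylM; exact: tits_cone_segment.
Qed.

Lemma is_face_tits_cone : is_face (tits_cone D).
Proof.
split => //.
- by exists 0, 1%g, 0; rewrite ?weyl1 // => i; rewrite lfunE.
- move=> x y t; rewrite !inE => Xx Xy; apply: tits_cone_convex => //.
  by apply/andP; split.
Qed.

(** With [delta] the sum of the [c_i h_i], the value on [delta] can only grow
when a reflection that increases the length is applied: the change is the
product of a nonnegative number and of minus the value of a simple root on
[delta]. *)
Lemma tits_cone_antidominant (c : 'I_n -> R) l :
  (forall i, 0 <= c i) -> (forall j, \sum_i c i * (A i j)%:~R <= 0) ->
  tits_cone D l -> 0 <= \sum_i c i * pairing l i.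
Proof.
move=> c0 cA [w [m dm ->]].
have [N] := ubnP (len w); elim: N w => // N IH w wN.
have [->|/len_descent[j wj]] := pselect (w = 1%g).
  by rewrite weyl1 sumr_ge0 // => i _; rewrite mulr_ge0 //; apply: dm.
have -> : w = (simple D j * (simple D j * w))%g by rewrite simpleMK.
move: wj; set v : weyl D := (simple D j * w)%g => wj.
have vj : 0 <= pairing (v m) j.
  by apply: tits_lemma => //; rewrite /v simpleMK ltnW.
rewrite weylM (eq_bigr (fun i => c i * pairing (v m) i
    - pairing (v m) j * (c i * (A i j)%:~R))); last first.
  by move=> i _; rewrite pairing_simple; ring.
rewrite sumrB -mulr_sumr subr_ge0 (le_trans (y := 0)) //.
  by rewrite mulr_ge0_le0.
by apply: IH; apply: leq_trans wj _.
Qed.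

Definition zeros l : {set 'I_n} := [set i | pairing l i == 0]%SET.

Lemma zerosP l i : reflect (pairing l i = 0) (i \in zeros l).
Proof. by rewrite finset.in_set; apply: eqP. Qed.

(** If [i] shortens [w], then [w l] is nonpositive on [h_i]; as [w l] is dominant
it lies on the wall [i], and [i] can be removed from [w] without changing
[w l]. *)
Theorem fundamental_domain w l : dominant l -> dominant (w l) ->
  w l = l /\ parabolic D (zeros l) w.
Proof.
move=> dl; have [N] := ubnP (len w); elim: N w => // N IH w wN dwl.
have [->|/len_descent[i wi]] := pselect (w = 1%g).
  by rewrite weyl1; split=> //; apply: parabolic1.
have vi : 0 <= pairing (weyl_fun (simple D i * w)%g l) i.
  by apply: tits_lemma => //; rewrite simpleMK ltnW.
have wli : pairing (w l) i = 0.
  have wl0 : 0 <= pairing (w l) i by exact: dwl.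
  by move: vi; rewrite weylM pairing_simple_diag; lra.
have e : weyl_fun (simple D i * w)%g l = w l by rewrite weylM simple_fix.
have [||el lw] := IH (simple D i * w)%g; rewrite ?e //.
  exact: leq_trans wi _.
split; first by rewrite -e.
rewrite -(simpleMK i w); apply: parabolicM => //; apply: parabolic_simple.
by apply/zerosP; rewrite -[l]el e.
Qed.

End TitsConeGeometry.

(** * Linear alternatives *)

Section Alternatives.
Local Open Scope ring_scope.
Variable F : realFieldType.

Lemma small_perturbation (I : finType) (a b : I -> F) : (forall i, 0 < a i) ->
  exists2 e, 0 < e < 1 & forall i, 0 < a i + e * b i.
Proof.
move=> a0; pose S := \sum_i `|b i| / a i.
have S0 : 0 <= S by apply: sumr_ge0 => i _; rewrite divr_ge0 // ltW.
exists (2 + S)^-1.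
  by apply/andP; split; rewrite ?invr_gt0 ?invf_lt1; lra.
move=> i.
have bS : `|b i| / a i <= S.
  rewrite /S (bigD1 i) //= lerDl sumr_ge0 // => j _.
  by rewrite divr_ge0 // ltW.
have {}bS : `|b i| < a i * (2 + S).
  by move: bS; rewrite ler_pdivrMr //; have := a0 i; nra.
have bN : 0 <= `|b i| + b i by have := ler_norm (- b i); rewrite normrN; lra.
have e0 : 0 < (2 + S)^-1 by rewrite invr_gt0; lra.
have eb : (2 + S)^-1 * `|b i| < a i by rewrite mulrC ltr_pdivrMr //; lra.
have := mulr_ge0 (ltW e0) bN; rewrite mulrDr; lra.
Qed.

Definition dot n (u v : 'rV[F]_n) : F := \sum_i u 0 i * v 0 i.

Lemma dotDl n (u v w : 'rV[F]_n) : dot (u + v) w = dot u w + dot v w.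
Proof. by rewrite -big_split; apply: eq_bigr => i _; rewrite mxE mulrDl. Qed.

Lemma dotZl n a (u w : 'rV[F]_n) : dot (a *: u) w = a * dot u w.
Proof. by rewrite mulr_sumr; apply: eq_bigr => i _; rewrite mxE mulrA. Qed.

Lemma dotC n (u v : 'rV[F]_n) : dot u v = dot v u.
Proof. by apply: eq_bigr => i _; rewrite mulrC. Qed.

Lemma dotDr n (u v w : 'rV[F]_n) : dot u (v + w) = dot u v + dot u w.
Proof. by rewrite ![dot u _]dotC dotDl. Qed.

Lemma dotZr n a (u w : 'rV[F]_n) : dot u (a *: w) = a * dot u w.
Proof. by rewrite ![dot u _]dotC dotZl. Qed.

Lemma dot_sumr n (u : 'rV[F]_n) (I : finType) (c : I -> F) (v : I -> 'rV[F]_n) :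
  dot u (\sum_i c i *: v i) = \sum_i c i * dot u (v i).
Proof.
elim/big_ind2: _ => [|x1 x2 y1 y2|i _].
- by rewrite -(scale0r 0) dotZr mul0r.
- by move=> /= <- <-; rewrite dotDr.
- exact: dotZr.
Qed.

Lemma dot_gt0 n (u : 'rV[F]_n) : u != 0 -> 0 < dot u u.
Proof.
move=> u0; have d0 i : 0 <= u 0 i * u 0 i by rewrite -expr2 sqr_ge0.
rewrite lt_neqAle sumr_ge0 // andbT; apply: contraNneq u0 => /esym/eqP.
rewrite psumr_eq0 // => /allP u0; apply/eqP/rowP => i; rewrite mxE.
by have := u0 i (mem_index_enum _); rewrite mulf_eq0 orbb => /eqP.
Qed.

(** Induction on the number of vectors.  If [y] is negative on all vectors but
the first one [v0], and nonnegative on [v0], apply the induction hypothesis to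
the projections of the other vectors along [v0].  A form negative on the
projections gives one that vanishes on [v0] and can be perturbed; a positive
relation between the projections says that a positive combination of the other
vectors is a multiple of [v0], and evaluating [y] shows that the factor is
nonpositive. *)
Theorem gordan n N (v : 'I_N -> 'rV[F]_n) :
  (exists y, forall i, dot y (v i) < 0) \/
  (exists c : 'I_N -> F, [/\ forall i, 0 <= c i, exists i, 0 < c i &
    \sum_i c i *: v i = 0]).
Proof.
elim: N v => [|N IH] v; first by left; exists 0 => -[].
pose v0 := v ord0; pose v' k := v (lift ord0 k).
pose ext (a : F) (c : 'I_N -> F) (i : 'I_N.+1) := oapp c a (unlift ord0 i).
have ext0 a c : ext a c ord0 = a by rewrite /ext unlift_none.
have extS a c k : ext a c (lift ord0 k) = c k by rewrite /ext liftK.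
have ext_ge0 a c : 0 <= a -> (forall k, 0 <= c k) -> forall i, 0 <= ext a c i.
  by move=> a0 c0 i; rewrite /ext; case: unlift.
have ext_sum a c : \sum_i ext a c i *: v i = a *: v0 + \sum_k c k *: v' k.
  rewrite big_ord_recl ext0; congr (_ + _).
  by apply: eq_bigr => k _; rewrite extS.
case: (IH v') => [[y yv']|[c [c0 [k ck] cv]]]; last first.
  right; exists (ext 0 c); split; first exact: ext_ge0.
    by exists (lift ord0 k); rewrite extS.
  by rewrite ext_sum cv scale0r addr0.
have [yv0|yv0] := ltP (dot y v0) 0.
  by left; exists y => i; case: (unliftP ord0 i) => [k ->|->] //; apply: yv'.
have [v00|/dot_gt0 q0] := eqVneq v0 0.
  right; exists (ext 1 (fun=> 0)); split; first exact: ext_ge0.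
    by exists ord0; rewrite ext0.
  by rewrite ext_sum v00 scaler0 add0r big1 // => k _; rewrite scale0r.
set q := dot v0 v0 in q0.
pose u k := v' k + (- (dot v0 (v' k) / q)) *: v0.
case: (IH u) => [[y' yu]|[c [c0 [k ck] cu]]].
- left; pose y2 := y' + (- (dot y' v0 / q)) *: v0.
  have y2v0 : dot y2 v0 = 0.
    by rewrite /y2 dotDl dotZl mulNr divfK ?subrr // gt_eqF.
  have y2v k : 0 < - dot y2 (v' k).
    rewrite oppr_gt0; have := yu k; rewrite /u /y2 dotDr dotZr dotDl dotZl.
    by congr (_ + _ < 0); field; rewrite gt_eqF.
  have [e /andP[e0 _] eP] := small_perturbation (fun k => dot v0 (v' k)) y2v.
  exists (y2 + (- e) *: v0) => i; case: (unliftP ord0 i) => [k ->|->].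
    by rewrite dotDl dotZl; have := eP k; rewrite -/(v' k); lra.
  by rewrite dotDl dotZl -/v0 y2v0 add0r mulNr oppr_lt0 mulr_gt0.
- right; pose s := \sum_k c k * (dot v0 (v' k) / q).
  have cv : \sum_k c k *: v' k = s *: v0.
    rewrite /s scaler_suml; apply/eqP.
    rewrite -subr_eq0 -sumrB -[X in _ == X]cu; apply/eqP.
    by apply: eq_bigr => j _; rewrite /u scalerDr scalerA mulrN scaleNr.
  have s0 : s <= 0.
    rewrite leNgt; apply/negP => s0.
    have : dot y (\sum_k c k *: v' k) < 0.
      rewrite dot_sumr (bigD1 k) //=.
      rewrite -[ltRHS]addr0 ltr_leD //; first by rewrite pmulr_rlt0.
      by rewrite sumr_le0 // => j _; rewrite mulr_ge0_le0 // ltW.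
    by rewrite cv dotZr ltNge mulr_ge0 // ltW.
  exists (ext (- s) c); split.
  + by apply: ext_ge0; rewrite ?oppr_ge0.
  + by exists (lift ord0 k); rewrite extS.
  + by rewrite ext_sum cv scaleNr addNr.
Qed.

(** The alternative [gordan] for the columns of [M] together with the opposites
of the unit vectors. *)
Theorem ville m (M : 'I_m -> 'I_m -> F) :
  (exists x, [/\ forall j, 0 <= x j, exists j, 0 < x j &
     forall i, 0 <= \sum_j M i j * x j]) \/
  (exists2 y, forall i, 0 < y i & forall j, \sum_i M i j * y i < 0).
Proof.
pose v (k : 'I_(m + m)) : 'rV[F]_m := match fintype.split k with
  | inl i => - delta_mx 0 i | inr j => \row_i M i j end.
have vl i : v (lshift m i) = - delta_mx 0 i by rewrite /v (unsplitK (inl i)).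
have vr j : v (rshift m j) = \row_i M i j by rewrite /v (unsplitK (inr j)).
case: (gordan v) => [[y yv]|[c [c0 [k ck] cv]]]; [right|left].
  exists (fun i => y 0 i) => [i|j].
    have := yv (lshift m i); rewrite vl /dot (bigD1 i) //= big1 => [|j ji].
      by rewrite !mxE !eqxx addr0 mulrN1 oppr_lt0.
    by rewrite !mxE eqxx (negPf ji) oppr0 mulr0.
  have := yv (rshift m j); rewrite vr /dot.
  by under eq_bigr do rewrite mxE mulrC.
have cE i : c (lshift m i) = \sum_j M i j * c (rshift m j).
  have /rowP/(_ i) := cv; rewrite big_split_ord /= mxE !summxE [in RHS]mxE.
  rewrite (bigD1 i) //= big1 => [|j ji].
    rewrite vl !mxE !eqxx addr0 mulrN1 => /eqP; rewrite addrC subr_eq0 => /eqP <-.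
    by apply: eq_bigr => j _; rewrite vr !mxE mulrC.
  by rewrite vl !mxE eqxx eq_sym (negPf ji) oppr0 mulr0.
exists (fun j => c (rshift m j)); split=> // [|i]; last by rewrite -cE.
case: (split_ordP k) ck => [i ->|j ->]; last by exists j.
rewrite cE => /lt0r_neq0; apply: contraNP => /forallNP h.
rewrite big1 // => j _; apply/eqP; rewrite mulf_eq0; apply/orP; right.
by rewrite eq_le c0 andbT leNgt; apply/negP/h.
Qed.

Lemma min_ratio m (v u : 'I_m -> F) : (0 < m)%N -> (forall i, 0 < u i) ->
  exists s, (forall j, s * u j <= v j) /\ exists i, v i = s * u i.
Proof.
case: m v u => // m v u _ u0; pose r i := v i / u i.
have ruE i : r i * u i = v i by rewrite divfK // gt_eqF.
case: (@arg_minP _ F _ ord0 predT r) => // i _ rmin.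
exists (r i); split; last by exists i.
by move=> j; rewrite -[leRHS]ruE ler_wpM2r ?rmin // ltW.
Qed.

End Alternatives.

(** * Indecomposable matrices that are not of finite type *)

Section Kac.
Local Open Scope ring_scope.
Variables (F : realFieldType) (m : nat).
Implicit Types (M : 'M[F]_m) (u v : 'I_m -> F).

(** Connectedness of the diagram, in the form in which it is used: a nonempty
set of indices that is closed under adjacency is everything. *)
Definition irreducible M := forall P : pred 'I_m, (exists i, P i) ->
  (forall i j, P i -> M i j != 0 -> P j) -> forall i, P i.

(** In a row [i] with [v i = 0] all terms of [M v] are nonpositive, so they
vanish, and the zeros of [v] spread along the edges of the diagram. *)
Lemma nonneg_eq0 M v : (forall i j, i != j -> M i j <= 0) -> irreducible M ->
  (forall i, 0 <= v i) -> (forall i, 0 <= \sum_j M i j * v j) ->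
  (exists i, v i = 0) -> forall i, v i = 0.
Proof.
move=> Mo irr v0 Mv [i0 vi0] i; apply/eqP; move: i.
apply: (irr (fun i => v i == 0)); first by exists i0; apply/eqP.
move=> i j /eqP vi Mij.
have t0 k : 0 <= - (M i k * v k).
  have [<-|ik] := eqVneq i k; first by rewrite vi mulr0 oppr0.
  by rewrite oppr_ge0 mulr_le0_ge0 // Mo.
have : \sum_k - (M i k * v k) == 0.
  by rewrite eq_le sumr_ge0 // andbT sumrN oppr_le0.
rewrite psumr_eq0 // => /allP/(_ j (mem_index_enum _)).
by rewrite oppr_eq0 mulf_eq0 (negPf Mij).
Qed.

Lemma irreducible_tr M : (forall i j, M i j = 0 -> M j i = 0) ->
  irreducible M -> irreducible M^T.
Proof.
move=> M0 irr P exP PM; apply: irr => // i j Pi Mij; apply: (PM i j) => //.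
by rewrite mxE; apply: contraNneq Mij => /M0 ->.
Qed.

End Kac.

Section KacTrichotomy.
Local Open Scope ring_scope.
Variables (R : realType) (m : nat) (B : 'M[int]_m).
Let M : 'M[R]_m := map_mx intr B.
Hypothesis Bo : forall i j, i != j -> B i j <= 0.
Hypothesis B0 : forall i j, B i j = 0 -> B j i = 0.
Hypothesis irr : irreducible M.

Let Mo i j : i != j -> M i j <= 0.
Proof. by move=> ij; rewrite mxE lerz0 Bo. Qed.

Let M0 i j : M i j = 0 -> M j i = 0.
Proof. by rewrite !mxE => /eqP; rewrite intr_eq0 => /eqP/B0 ->. Qed.

(** If [M v >= 0] but [v] is neither positive nor zero, subtract from [v] the
largest multiple of [u] that keeps it nonnegative.  The multiple is nonpositive,
so [nonneg_eq0] applies and [v] is a multiple [s u] with [s < 0], against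
[M u <> 0]. *)
Lemma finite_type_criterion (u : 'I_m -> R) :
  (forall i, 0 < u i) -> (forall i, 0 <= \sum_j M i j * u j) ->
  (exists i, \sum_j M i j * u j != 0) -> finite_type R B.
Proof.
move=> u0 Mu [i0 Mui0].
have m0 : (0 < m)%N by apply: leq_ltn_trans (ltn_ord i0).
have inv (v : 'cV[R]_m) : (forall i, 0 <= (M *m v) i 0) ->
    (forall i, 0 < v i 0) \/ v = 0.
  move=> Mv; apply: contrapT => /not_orP[/existsNP[i1 /negP]].
  rewrite -leNgt => vi1 v0.
  have [s [sv [i vi]]] := min_ratio (fun i => v i 0) m0 u0.
  pose w j := v j 0 + (- s) * u j.
  have s0 : s <= 0.
    rewrite leNgt; apply/negP => s1.
    by have := mulr_gt0 s1 (u0 i1); have /= := sv i1; lra.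
  have MwE j : \sum_k M j k * w k = (M *m v) j 0 + (- s) * \sum_k M j k * u k.
    rewrite mxE mulr_sumr -big_split; apply: eq_bigr => k _.
    by rewrite /w /=; ring.
  have w0 j : w j = 0.
    apply: (nonneg_eq0 Mo irr) => [k|k|].
    - by rewrite /w; have := sv k; lra.
    - by rewrite MwE addr_ge0 // mulr_ge0 // oppr_ge0.
    - by exists i; rewrite /w vi; lra.
  have s1 : s != 0.
    apply/eqP => s1; apply: v0; apply/colP => j; rewrite mxE.
    by have := w0 j; rewrite /w s1; lra.
  have := MwE i0; rewrite big1 => [|k _]; last by rewrite w0 mulr0.
  have := Mv i0; have := Mu i0; move: Mui0 => /eqP Mui0 Mu1 Mv1 /esym e.
  by apply: Mui0; move: s1 => /eqP s1; nra.
have detM : \det M != 0.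
  apply/negP; rewrite -det_tr => /det0P[v v0 vM].
  have Mv : M *m v^T = 0 by rewrite -[M]trmxK -trmx_mul vM trmx0.
  have vt0 : v^T <> 0 by move=> e; move/eqP: v0; apply; rewrite -[v]trmxK e trmx0.
  case: (inv v^T) => [i|vp|//]; first by rewrite Mv mxE.
  case: (inv (- v^T)) => [i|vn|/eqP]; first by rewrite mulmxN Mv !mxE oppr0.
    by have := vp i0; have := vn i0; rewrite [(- v^T) i0 0]mxE; lra.
  by rewrite oppr_eq0 => /eqP.
split=> //.
have uM : M \in unitmx by rewrite unitmxE unitfE.
pose w : 'cV[R]_m := invmx M *m const_mx 1.
have Mw : M *m w = const_mx 1 by rewrite mulKVmx.
exists w; last by move=> i; rewrite Mw mxE.
case: (inv w) => // [i|w0]; first by rewrite Mw mxE.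
have := congr1 (fun v : 'cV_m => v i0 0) Mw; rewrite w0 mulmx0 !mxE => /eqP.
by rewrite eq_sym oner_eq0.
Qed.

(** By [ville] either such a vector exists, even with strict inequalities, or
there is [u > 0] with [M u >= 0], and then [M u = 0] since [M] is not of finite
type.  In this affine case [ville] is applied to the transposed matrix: a
positive [c] with [c M >= 0] satisfies [c M = 0], as pairing with [u] shows, and
a vector [y > 0] with [M y < 0] is impossible, since the largest multiple of [y]
below [u] would give a contradiction with [nonneg_eq0]. *)
Theorem nonfinite_type_vector : ~ finite_type R B ->
  exists2 c : 'I_m -> R, forall i, 0 < c i &
    forall j, \sum_i c i * (B i j)%:~R <= 0.
Proof.
move=> nfin.
suff [c c0 cM] : exists2 c : 'I_m -> R, forall i, 0 < c i &
    forall j, \sum_i M i j * c i <= 0.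
  exists c => // j; have := cM j.
  by under eq_bigr do rewrite mxE mulrC.
have pos (N : 'M[R]_m) (x : 'I_m -> R) : (forall i j, i != j -> N i j <= 0) ->
    irreducible N -> (forall i, 0 <= x i) -> (exists i, 0 < x i) ->
    (forall i, 0 <= \sum_j N i j * x j) -> forall i, 0 < x i.
  move=> No Nirr x0 [i xi] Nx k; rewrite lt_neqAle x0 andbT eq_sym.
  apply/eqP => xk; have := nonneg_eq0 No Nirr x0 Nx (ex_intro _ k xk) i.
  by move=> e; rewrite e ltxx in xi.
case: (ville M) => [[u [u0 [i0 ui0] Mu]]|[y y0 My]]; last first.
  by exists y => // j; apply: ltW.
have {}u0 : forall i, 0 < u i by apply: (pos M u Mo irr u0 _ Mu); exists i0.
have {}Mu i : \sum_j M i j * u j = 0.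
  apply: contra_notP nfin => /eqP Mui.
  by apply: (finite_type_criterion u0 Mu); exists i.
have m0 : (0 < m)%N by apply: leq_ltn_trans (ltn_ord i0).
case: (ville (fun i j => M j i)) => [[c [c0 [i1 ci1] Mc]]|[y y0 My]].
- have {}c0 : forall i, 0 < c i.
    apply: (pos M^T c _ (irreducible_tr M0 irr) c0).
    + by move=> i j ij; rewrite mxE Mo // eq_sym.
    + by exists i1.
    + by move=> i; under eq_bigr do rewrite [_^T _ _]mxE.
  exists c => // j.
  have t0 k : 0 <= u k * \sum_i M i k * c i by rewrite mulr_ge0 // ltW.
  have : \sum_k u k * \sum_i M i k * c i == 0.
    under eq_bigr do rewrite mulr_sumr.
    rewrite exchange_big /= big1 // => i _.
    transitivity (c i * \sum_k M i k * u k); last by rewrite Mu mulr0.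
    rewrite mulr_sumr.
    by apply: eq_bigr => k _; ring.
  rewrite psumr_eq0 // => /allP/(_ j (mem_index_enum _)) /=.
  by rewrite mulf_eq0 (gt_eqF (u0 j)) => /eqP ->.
- have [s [su [i ui]]] := min_ratio u m0 y0.
  have s0 : 0 < s by have := u0 i; rewrite ui pmulr_lgt0.
  pose v j := u j - s * y j.
  have MvE k : \sum_j M k j * v j = - s * \sum_j M k j * y j.
    transitivity (\sum_j M k j * u j - s * \sum_j M k j * y j).
      rewrite mulr_sumr -sumrB.
      by apply: eq_bigr => j _; rewrite /v; ring.
    by rewrite Mu add0r mulNr.
  have v0 j : v j = 0.
    apply: (nonneg_eq0 Mo irr) => [k|k|].
    - by rewrite subr_ge0.
    - by rewrite MvE mulNr oppr_ge0 pmulr_rle0 // ltW.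
    - by exists i; rewrite /v ui subrr.
  have := MvE i; rewrite big1 => [|j _]; last by rewrite v0 mulr0.
  move=> /esym/eqP; rewrite mulf_eq0 oppr_eq0 (gt_eqF s0) /= (lt_eqF (My i)).
  by [].
Qed.

End KacTrichotomy.

(** * Components of finite type *)

Section PositiveDefinite.
Local Open Scope ring_scope.
Variables (F : realFieldType) (m : nat) (S : 'M[F]_m).
Hypothesis S_sym : forall i j, S i j = S j i.
Hypothesis S_off : forall i j, i != j -> S i j <= 0.
Implicit Types c u : 'I_m -> F.

Definition quadratic c : F := \sum_i c i * \sum_j S i j * c j.

(** The arithmetic-geometric inequality
[2 c_i c_j <= u_j c_i^2 / u_i + u_i c_j^2 / u_j], multiplied by [S i j <= 0], for
every off-diagonal term.  When [S u > 0] the form is thus positive definite,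
with an explicit bound. *)
Lemma quadratic_ge u c : (forall i, 0 < u i) ->
  \sum_i (\sum_j S i j * u j) / u i * c i ^+ 2 <= quadratic c.
Proof.
move=> u0.
pose h i j := S i j * u j / u i * c i ^+ 2.
have -> : \sum_i (\sum_j S i j * u j) / u i * c i ^+ 2 =
    \sum_i \sum_j (h i j + h j i) / 2.
  have e : \sum_i \sum_j h j i = \sum_i \sum_j h i j by rewrite exchange_big.
  under [RHS]eq_bigr do rewrite -mulr_suml big_split.
  rewrite -mulr_suml big_split /= e -mulr2n -[_ *+ 2]mulr_natr mulfK ?pnatr_eq0 //.
  apply: eq_bigr => i _; rewrite -mulrA mulr_suml.
  by apply: eq_bigr => j _; rewrite /h; ring.
apply: ler_sum => i _; rewrite mulr_sumr; apply: ler_sum => j _.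
have [<-|ij] := eqVneq i j.
  by rewrite /h mulfK ?gt_eqF //; lra.
have ui := u0 i; have uj := u0 j.
have amgm : c i * c j * 2 <= u j / u i * c i ^+ 2 + u i / u j * c j ^+ 2.
  rewrite -subr_ge0.
  have -> : u j / u i * c i ^+ 2 + u i / u j * c j ^+ 2 - c i * c j * 2 =
      (u j * c i - u i * c j) ^+ 2 / (u i * u j).
    by field; rewrite !gt_eqF.
  by rewrite divr_ge0 ?sqr_ge0 // mulr_ge0 // ltW.
rewrite ler_pdivrMr // /h (S_sym j i).
have := ler_wnM2l (S_off ij) amgm; lra.
Qed.

Lemma sum_delta (f : 'I_m -> F) i : \sum_k f k * (k == i)%:R = f i.
Proof.
rewrite (bigD1 i) //= big1 => [|k /negPf->]; last by rewrite mulr0.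
by rewrite eqxx mulr1 addr0.
Qed.

Lemma quadratic_add c i t :
  quadratic (fun k => c k + t * (k == i)%:R) =
  quadratic c + 2 * t * (\sum_j S i j * c j) + t ^+ 2 * S i i.
Proof.
have row k : \sum_j S k j * (c j + t * (j == i)%:R) =
    \sum_j S k j * c j + t * S k i.
  rewrite -(sum_delta (S k)) mulr_sumr -big_split; apply: eq_bigr => j _ /=.
  by ring.
rewrite /quadratic; under eq_bigr do rewrite row.
have e1 : \sum_k c k * (t * S k i) = t * \sum_j S i j * c j.
  by rewrite mulr_sumr; apply: eq_bigr => k _; rewrite S_sym; ring.
have e2 : \sum_k (k == i)%:R * (\sum_j S k j * c j + t * S k i) =
    \sum_j S i j * c j + t * S i i.
  by under eq_bigr do rewrite mulrC; rewrite sum_delta.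
rewrite (eq_bigr (fun k => c k * (\sum_j S k j * c j) + c k * (t * S k i)
    + t * ((k == i)%:R * (\sum_j S k j * c j + t * S k i)))); last first.
  by move=> k _; ring.
by rewrite !big_split /= e1 -mulr_sumr e2; ring.
Qed.

End PositiveDefinite.

Section Descent.
Local Open Scope ring_scope.
Variables (R : realType) (n : nat) (A : 'M[int]_n) (D : realization R A).
Variable K : {set 'I_n}.
Implicit Types x : weight D.
Let m := #|K|.
Let M : 'M[R]_m := map_mx intr (principal_submx A K).

Let ME a b : M a b = (A (enum_val a) (enum_val b))%:~R.
Proof. by rewrite !mxE. Qed.

Hypothesis irr : irreducible M.

(** The entries of a symmetrizer may have any sign, but for adjacent indices the
signs agree because [A i j] and [A j i] are both negative.  On an indecomposable
block one can therefore normalize the sign. *)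
Lemma positive_symmetrizer : (0 < m)%N ->
  exists2 d : 'I_m -> R, forall a, 0 < d a &
    forall a b, M a b / d a = M b a / d b.
Proof.
move=> m0; pose a0 := Ordinal m0.
have [d [B [d0 BT AB]]] := realization_symmetrizable D.
pose e (a : 'I_m) : 'I_n := enum_val a.
have MB a b : M a b = d 0 (e a) * B (e a) (e b).
  have := congr1 (fun X : 'M_n => X (e a) (e b)) AB.
  by rewrite mul_diag_mx !mxE => <-.
have Bs a b : B (e a) (e b) = B (e b) (e a) by rewrite -{1}BT mxE.
have sq a : 0 < d 0 (e a) * d 0 (e a).
  by rewrite -expr2 exprn_even_gt0 //= d0.
exists (fun a => d 0 (e a0) * d 0 (e a)); last first.
  by move=> a b; rewrite !MB (Bs b a); field; rewrite !d0.
apply: irr; first by exists a0.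
move=> a b da; have [<-//|ab] := eqVneq a b.
move=> Mab.
have Mlt p q : p != q -> M p q != 0 -> M p q < 0.
  move=> pq Mpq; rewrite lt_neqAle Mpq ME lerz0 (A_offdiag D) //.
  by rewrite (inj_eq enum_val_inj).
have Mba : M b a != 0.
  by apply: contraNneq Mab; rewrite !ME => /eqP; rewrite intr_eq0 => /eqP/(A_zero D) ->.
have ba : b != a by rewrite eq_sym.
have := Mlt _ _ ab Mab; have := Mlt _ _ ba Mba; rewrite !MB (Bs b a).
move: (B _ _) (sq a) (sq b) (sq a0) da => y sa sb s0 da h1 h2.
have h3 : 0 < (d 0 (e b) * y) * (d 0 (e a) * y) by rewrite nmulr_rgt0.
have h4 : 0 < d 0 (e b) * d 0 (e a).
  have y2 : 0 <= y ^+ 2 by exact: sqr_ge0.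
  by rewrite ltNge; apply/negP => h; move: h3; nra.
rewrite ltNge; apply/negP => h; have := mulr_gt0 da h4; nra.
Qed.

(** Invertibility of [M] gives coordinates [c] in the simple roots for the
restriction of [x] to [K].  Reflecting at an [i] with [x(h_i) < 0] leaves the
positive definite form unchanged and, by integrality, increases the sum of the
coordinates by at least 1.  As the form bounds this sum, the process stops. *)
Lemma finite_type_dominantize x : finite_type R (principal_submx A K) ->
  (forall i, i \in K -> pairing x i \is a Num.int) ->
  exists2 w, parabolic D K w & forall i, i \in K -> 0 <= pairing (w x) i.
Proof.
case=> detM [u u0 Mu] _ xint.
have [K0|m0] := posnP m.
  exists 1%g; first exact: parabolic1.
  by move=> i; rewrite (cards0_eq K0) finset.in_set0.
have [d d0 Msym] := positive_symmetrizer m0.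
pose S : 'M[R]_m := \matrix_(a, b) (M a b / d a).
have SE a b : S a b = M a b / d a by rewrite [LHS]mxE.
have S_sym a b : S a b = S b a by rewrite !SE Msym.
have S_off a b : a != b -> S a b <= 0.
  move=> ab; rewrite SE pmulr_lle0 ?invr_gt0 // ME lerz0.
  by rewrite (A_offdiag D) // (inj_eq enum_val_inj).
have SM a (c : 'I_m -> R) : \sum_b S a b * c b = (\sum_b M a b * c b) / d a.
  by rewrite mulr_suml; apply: eq_bigr => b _; rewrite SE; ring.
pose g a := (\sum_b S a b * u b 0) / u a 0.
have g0 a : 0 < g a.
  rewrite /g SM !divr_gt0 //; have := Mu a.
  by rewrite mxE.
pose bound q := \sum_a (1 + q / g a).
have sum_le (c : 'I_m -> R) : \sum_a c a <= bound (quadratic S c).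
  apply: ler_sum => a _.
  have h : g a * c a ^+ 2 <= quadratic S c.
    apply: le_trans (quadratic_ge S_sym S_off c u0).
    rewrite (bigD1 a) //= -/(g a) lerDl sumr_ge0 // => b _.
    by rewrite mulr_ge0 ?sqr_ge0 // ltW // g0.
  have h2 : c a ^+ 2 <= quadratic S c / g a by rewrite ler_pdivlMr // mulrC.
  have := sqr_ge0 (c a - 2^-1); lra.
have step (c : 'I_m -> R) a :
    quadratic S (fun b => c b + (- \sum_b M a b * c b) * (b == a)%:R) =
    quadratic S c.
  rewrite quadratic_add // SM SE ME (A_diag D).
  rewrite (_ : 2%:~R = 2 :> R) //; by field; rewrite gt_eqF.
have [c cx] : exists c : 'I_m -> R,
    forall a, pairing x (enum_val a) = \sum_b M a b * c b.
  pose X : 'cV[R]_m := \col_a pairing x (enum_val a).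
  exists (fun a => (invmx M *m X) a 0) => a.
  have uM : M \in unitmx by rewrite unitmxE unitfE.
  have := congr1 (fun Y : 'cV_m => Y a 0) (mulKVmx uM X).
  by rewrite mxE => ->; rewrite mxE.
(* [N] bounds the number of reflections that are still possible *)
have [N cN] : exists N : nat, bound (quadratic S c) < \sum_a c a + N%:R.
  exists (Num.Def.archi_bound `|bound (quadratic S c) - \sum_a c a|).
  rewrite -ltrBlDl; apply: le_lt_trans (ler_norm _) _.
  exact: archi_boundP.
elim: N x xint c cx cN => [|N IH] x xint c cx cN.
  by have := le_lt_trans (sum_le c) cN; rewrite addr0 ltxx.
have [dx|] := pselect (forall i, i \in K -> 0 <= pairing x i).
  by exists 1%g; rewrite ?weyl1 //; apply: parabolic1.
move=> /existsNP[i /not_implyP[Ki /negP]]; rewrite -ltNge => xi.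
pose a := enum_rank_in Ki i.
have ea : enum_val a = i by rewrite enum_rankK_in.
have ci : \sum_b M a b * c b = pairing x i by rewrite -cx ea.
have [|||w Kw dw] := IH (simple D i x) _
  (fun b => c b + (- \sum_b M a b * c b) * (b == a)%:R).
- move=> k Kk; rewrite pairing_simple rpredB ?rpredM ?xint //.
  exact: intr_int.
- move=> b; rewrite pairing_simple cx ci.
  under [RHS]eq_bigr do rewrite mulrDr mulrCA.
  rewrite big_split /= -mulr_sumr sum_delta ME ea; ring.
- rewrite step; apply: lt_le_trans cN _.
  have d1 : \sum_b (b == a)%:R = 1 :> R.
    by rewrite -[RHS](sum_delta (fun=> 1) a); apply: eq_bigr => b _; rewrite mul1r.
  rewrite big_split /= -mulr_sumr d1 mulr1 ci.
  have [z ez] := intrP (xint i Ki).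
  move: xi; rewrite ez ltrz0 => z0.
  have : z%:~R <= -1 :> R by rewrite (ler_int R z (-1)); lia.
  rewrite -[N.+1]addn1 natrD; lra.
exists (w * simple D i)%g.
  by apply: parabolicM => //; apply: parabolic_simple.
by move=> k Kk; rewrite weylM dw.
Qed.

End Descent.

(** * Components of special sets *)

Section Components.
Local Open Scope ring_scope.
Variables (R : realType) (n : nat) (A : 'M[int]_n) (D : realization R A).
Implicit Types (i j k : 'I_n) (J K Theta : {set 'I_n}).

Definition component J i : {set 'I_n} :=
  [set j in J | connect (diagram A J) i j]%SET.

Lemma in_component J i j :
  (j \in component J i) = (j \in J) && connect (diagram A J) i j.
Proof. by rewrite finset.in_set. Qed.

Lemma component_sub J i : component J i \subset J.
Proof. by apply/fintype.subsetP => j; rewrite in_component => /andP[]. Qed.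

Lemma component_refl J i : i \in J -> i \in component J i.
Proof. by move=> Ji; rewrite in_component Ji connect0. Qed.

Lemma component_edge J i j k :
  j \in component J i -> k \in J -> A j k != 0 -> k \in component J i.
Proof.
rewrite !in_component => /andP[Jj ij] Jk Ajk; rewrite Jk /=.
have [<-//|jk] := eqVneq j k.
by apply: connect_trans ij (connect1 _); apply/and4P.
Qed.

Lemma diagram_sym J : connect_sym (diagram A J).
Proof.
suff h i j : diagram A J i j -> diagram A J j i.
  by apply: sym_connect_sym => i j; apply/idP/idP; apply: h.
case/and4P => Ji Jj ij Aij; apply/and4P; split=> //; first by rewrite eq_sym.
by apply: contraNneq Aij => /(A_zero D) ->.
Qed.

Lemma component_irreducible J i : irreducible
  (map_mx intr (principal_submx A (component J i)) : 'M[R]_#|component J i|).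
Proof.
set K := component J i => P [a0 Pa0] PM a.
pose Q j := [exists a : 'I_#|K|, (enum_val a == j) && P a].
suff: Q (enum_val a).
  by case/existsP => b /andP[/eqP/enum_val_inj ->].
have: connect (diagram A J) (enum_val a0) (enum_val a).
  have := enum_valP a0; have := enum_valP a.
  rewrite !in_component => /andP[_ ia] /andP[_ ia0].
  by apply: connect_trans ia; rewrite (diagram_sym J).
case/connectP => p + ->; have: Q (enum_val a0).
  by apply/existsP; exists a0; rewrite eqxx.
elim: p (enum_val a0) (enum_valP a0) => //= k p IH j Kj Qj /andP[jk].
case/and4P: jk => Jj Jk jk Ajk; have Kk := component_edge Kj Jk Ajk.
apply: IH => //; case/existsP: Qj => b /andP[/eqP bj Pb].
apply/existsP; exists (enum_rank_in Kk k); rewrite enum_rankK_in // eqxx /=.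
by apply: PM Pb _; rewrite !mxE enum_rankK_in // bj intr_eq0.
Qed.

Lemma nonfinite_component_vector J i : 
  ~ finite_type R (principal_submx A (component J i)) ->
  exists c : 'I_n -> R, [/\ forall k, k \in component J i -> 0 < c k,
    forall k, k \notin component J i -> c k = 0 &
    forall j, \sum_k c k * (A k j)%:~R <= 0].
Proof.
set K := component J i => nfin.
have Bo (a b : 'I_#|K|) : a != b -> principal_submx A K a b <= 0.
  by move=> ab; rewrite mxE (A_offdiag D) // (inj_eq enum_val_inj).
have B0 (a b : 'I_#|K|) : principal_submx A K a b = 0 -> principal_submx A K b a = 0.
  by rewrite !mxE => /(A_zero D).
have [c c0 cA] := nonfinite_type_vector Bo B0 (@component_irreducible J i) nfin.
have c1 k : k \notin K -> \sum_(a | enum_val a == k) c a = 0.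
  by move=> Kk; rewrite big1 // => a /eqP ak; rewrite -ak enum_valP in Kk.
have c2 k : k \in K -> 0 < \sum_(a | enum_val a == k) c a.
  move=> Kk; rewrite (bigD1 (enum_rank_in Kk k)) ?enum_rankK_in //=.
  by rewrite ltr_pwDl // sumr_ge0 // => a _; apply: ltW.
exists (fun k => \sum_(a | enum_val a == k) c a); split=> // j.
have [Kj|Kj] := boolP (j \in K); last first.
  rewrite sumr_le0 // => k _; have [Kk|/c1->] := boolP (k \in K).
    rewrite pmulr_rle0 ?c2 // lerz0 (A_offdiag D) //.
    by apply: contraNneq Kj => <-.
  by rewrite mul0r.
have := cA (enum_rank_in Kj j).
rewrite (partition_big (@enum_val _ (mem K)) predT) //=; congr (_ <= 0).
apply: eq_bigr => k _; rewrite mulr_suml; apply: eq_bigr => a /eqP <-.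
by rewrite mxE enum_rankK_in.
Qed.

Lemma infpart_sub J : infpart R A J \subset J.
Proof.
apply/bigcupsP => K /andP[/imsetP[i _ ->] _]; exact: component_sub.
Qed.

Lemma special_component Theta k : special R A Theta -> k \in Theta ->
  exists2 i, k \in component Theta i &
    ~ finite_type R (principal_submx A (component Theta i)).
Proof.
move=> sT; rewrite {1}sT => /bigcupP[K /andP[/imsetP[i _ ->] /asboolPn nf] kK].
by exists i.
Qed.

Lemma nonspecial_component J : ~ special R A J -> exists2 k, k \in J &
  finite_type R (principal_submx A (component J k)).
Proof.
move=> nsp; apply: contrapT => h; apply: nsp; apply/eqP.
rewrite finset.eqEsubset infpart_sub andbT; apply/fintype.subsetP => k Jk.
apply/bigcupP; exists (component J k); last exact: component_refl.
apply/andP; split; first by apply/imsetP; exists k.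
by apply/asboolPn => fk; apply: h; exists k.
Qed.

(** The form in which non-finiteness is used: an antidominant nonnegative
combination of the coroots of [Theta] in which [h_k] occurs. *)
Lemma special_vector Theta k : special R A Theta -> k \in Theta ->
  exists c : 'I_n -> R, [/\ forall i, 0 <= c i, 0 < c k,
    forall i, i \notin Theta -> c i = 0 &
    forall j, \sum_i c i * (A i j)%:~R <= 0].
Proof.
move=> sT /(special_component sT)[i ki] /nonfinite_component_vector[c [c1 c0 cA]].
exists c; split=> //.
- by move=> j; case: (boolP (j \in component Theta i)) => [/c1/ltW|/c0 ->].
- exact: c1.
- move=> j Tj; apply: c0; apply: contra Tj; exact/fintype.subsetP/component_sub.
Qed.

Lemma in_perp J i : (i \in perp A J) = [forall j in J, A i j == 0].
Proof. by rewrite finset.in_set. Qed.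

Lemma perpP J i k : i \in perp A J -> k \in J -> A k i = 0.
Proof.
by rewrite in_perp => /forallP/(_ k)/implyP h /h/eqP; apply: (A_zero D).
Qed.

End Components.

(** * Faces of the Tits cone *)

Section Faces.
Local Open Scope ring_scope.
Local Open Scope classical_set_scope.
Variables (R : realType) (n : nat) (A : 'M[int]_n) (D : realization R A).
Implicit Types (i j k : 'I_n) (J K Theta : {set 'I_n}) (u v w : weyl D).
Implicit Types (l m x y z : weight D) (F : set (weight D)).

(** After moving [x] by an element of [W_Theta], which fixes the combination
[z], one may assume that [x] is nonnegative on [Theta].  The antidominant
[delta] of [special_vector] is nonnegative on [x] and [y] and zero on [z], hence
zero on [x]; since [h_k] occurs in [delta], [x] vanishes on [h_k]. *)
Lemma std_face_combination Theta x y (t : R) : special R A Theta ->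
  tits_cone D x -> tits_cone D y -> 0 < t < 1 ->
  (forall i, i \in Theta -> pairing (t *: x + (1 - t) *: y) i = 0) ->
  std_face D Theta x.
Proof.
move=> sT Xx Xy /andP[t0 t1] z0; split=> //.
set z := t *: x + _ in z0.
have [v Tv vx0] := tits_cone_dominantize Theta Xx.
have zE : v z = t *: v x + (1 - t) *: v y by rewrite /z linearD !linearZ.
have vz : v z = z by exact: parabolic_fix Tv z0.
have vx k : k \in Theta -> pairing (v x) k = 0.
  move=> Tk; have [c [c0 ck cT cA]] := special_vector D sT Tk.
  have h1 := tits_cone_antidominant c0 cA (tits_cone_weyl v Xx).
  have h2 := tits_cone_antidominant c0 cA (tits_cone_weyl v Xy).
  have : t * \sum_i c i * pairing (v x) i
       + (1 - t) * \sum_i c i * pairing (v y) i = 0.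
    rewrite !mulr_sumr -big_split big1 //= => i _.
    have -> : t * (c i * pairing (v x) i) + (1 - t) * (c i * pairing (v y) i)
      = c i * pairing (v z) i by rewrite zE pairingD !pairingZ; ring.
    rewrite vz; have [Ti|Ti] := boolP (i \in Theta); first by rewrite z0 ?mulr0.
    by rewrite cT ?mul0r.
  move=> h3; have : \sum_i c i * pairing (v x) i == 0.
    have t1p : 0 <= 1 - t by lra.
    rewrite eq_le h1 andbT -(pmulr_rle0 _ t0).
    by have := mulr_ge0 t1p h2; lra.
  rewrite psumr_eq0 => [|i _].
    move=> /allP/(_ k (mem_index_enum _)).
    by rewrite mulf_eq0 (gt_eqF ck) => /eqP.
  have [Ti|Ti] := boolP (i \in Theta); first by rewrite mulr_ge0 ?vx0.
  by rewrite cT ?mul0r.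
have xvx : x = v x.
  by rewrite -{1}(weylK v x); apply: parabolic_fix vx; apply: parabolicV.
by move=> i Ti; rewrite xvx; apply: vx.
Qed.

Lemma is_face_std_face Theta : special R A Theta -> is_face (std_face D Theta).
Proof.
move=> sT; split.
- by move=> x [].
- by exists 0; split; [apply: dominant_tits_cone => i; rewrite lfunE|
    move=> i _; rewrite lfunE].
- move=> x y t; rewrite !inE => -[Xx x0] [Xy y0]; split.
    by apply: tits_cone_convex => //; apply/andP; split.
  by move=> i Ti; rewrite !lfunE /= !lfunE /= x0 // y0 // !scaler0 addr0.
- move=> x y t Xx Xy t01 [_ z0]; split; first exact: std_face_combination z0.
  apply: (@std_face_combination _ _ x (1 - t)) => //; first by lra.
  by move=> i Ti; rewrite addrC (_ : 1 - (1 - t) = t); [exact: z0|lra].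
Qed.

Lemma std_facesT : std_faces D.
Proof. split; [exact: is_face_tits_cone|exact: is_face_std_face]. Qed.

(** Since [i] is adjacent to [Theta], the simple root [alpha_i] is negative on
the [delta] of some component of [Theta].  Hence [h_i + N delta] is antidominant
for large [N], so it is nonnegative on [l], whereas [delta] vanishes on [l]. *)
Lemma std_face_ge0 Theta l i : special R A Theta -> std_face D Theta l ->
  i \notin Theta -> i \notin perp A Theta -> 0 <= pairing l i.
Proof.
move=> sT [Xl l0] Ti; rewrite in_perp => /forall_inPn[k Tk Aik].
have [c [c0 ck cT cA]] := special_vector D sT Tk.
have ik (j : 'I_n) : j \in Theta -> j != i by apply: contraTneq => ->.
have Aki : (A k i)%:~R < 0 :> R.
  rewrite ltrz0 lt_neqAle (A_offdiag D) ?ik // andbT.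
  by apply: contraNneq Aik => /(A_zero D) ->.
have ci : \sum_j c j * (A j i)%:~R < 0.
  rewrite (bigD1 k) //= -[ltRHS]addr0 ltr_leD //; first by rewrite pmulr_rlt0.
  rewrite sumr_le0 // => j _; have [Tj|Tj] := boolP (j \in Theta).
    by rewrite mulr_ge0_le0 // lerz0 (A_offdiag D) // ik.
  by rewrite cT // mul0r.
pose N : R := - 2 / \sum_j c j * (A j i)%:~R.
have N0 : 0 <= N by rewrite /N mulNr -mulrN -invrN divr_ge0 // oppr_ge0 ltW.
have sumE (f : 'I_n -> R) : \sum_j ((j == i)%:R + N * c j) * f j =
    f i + N * \sum_j c j * f j.
  rewrite -{1}(sum_delta f i) mulr_sumr -big_split.
  by apply: eq_bigr => j _ /=; ring.
have := @tits_cone_antidominant _ _ _ D (fun j => (j == i)%:R + N * c j) l _ _ Xl.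
rewrite sumE [\sum_j c j * pairing l j]big1 ?mulr0 ?addr0 => [|j _].
  apply.
    by move=> j; rewrite addr_ge0 ?ler0n // mulr_ge0.
  move=> j; rewrite (sumE (fun j' => (A j' j)%:~R)).
  have [<-|ij] := eqVneq i j.
    by rewrite (A_diag D) /N divfK ?lt_eqF // (_ : 2%:~R = 2 :> R) // addrN.
  have := mulr_ge0_le0 N0 (cA j).
  have : (A i j)%:~R <= 0 :> R by rewrite lerz0 (A_offdiag D).
  lra.
have [Tj|Tj] := boolP (j \in Theta); last by rewrite cT ?mul0r.
by rewrite [pairing l j]l0 // mulr0.
Qed.

(** Only the coroots of [Theta^perp] can be negative on [l], by [std_face_ge0],
and [W_(Theta^perp)] does not change the values on [Theta]. *)
Lemma std_face_dominantize Theta l : special R A Theta -> std_face D Theta l ->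
  exists v, [/\ parabolic D (perp A Theta) v, dominant (v l) &
    forall i, i \in Theta -> pairing (v l) i = 0].
Proof.
move=> sT [Xl l0]; have [v Pv vl] := tits_cone_dominantize (perp A Theta) Xl.
have vl0 i : i \in Theta -> pairing (v l) i = 0.
  move=> Ti; rewrite (pairing_parabolic_perp _ Pv) ?[pairing _ _]l0 // => j Pj.
  exact: (perpP D Pj Ti).
exists v; split=> // i.
have [Ti|Ti] := boolP (i \in Theta); first by rewrite -/(pairing (v l) i) vl0.
have [Pi|Pi] := boolP (i \in perp A Theta); first exact: vl.
by apply: std_face_ge0 Ti Pi => //; split=> //; apply: tits_cone_weyl.
Qed.

Definition open_facet J : set (weight D) := [set l | dominant l /\ zeros l = J].

Lemma open_facet_pairing J l i : open_facet J l -> i \in J -> pairing l i = 0.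
Proof. by move=> [_ <-] /zerosP. Qed.

Lemma open_facet_gt0 J l i : open_facet J l -> i \notin J -> 0 < pairing l i.
Proof. by move=> [dl <-]; rewrite finset.in_set lt_def dl andbT. Qed.

Lemma open_facetP J l :
  (forall i, i \in J -> pairing l i = 0) ->
  (forall i, i \notin J -> 0 < pairing l i) -> open_facet J l.
Proof.
move=> l0 lp; split=> [i|].
  rewrite -/(pairing l i); have [Ji|/lp/ltW//] := boolP (i \in J).
  by rewrite l0.
apply/setP => i; apply/zerosP/idP => [li|/l0//].
by apply: contraT => /lp; rewrite li ltxx.
Qed.

Lemma exists_indicator J : exists l, forall i, pairing l i = (i \notin J)%:R.
Proof. exact: (exists_weight D). Qed.

Lemma indicator_facet J l :
  (forall i, pairing l i = (i \notin J)%:R) -> open_facet J l.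
Proof. by move=> lE; apply: open_facetP => i Ji; rewrite lE Ji ?ltr01. Qed.

Lemma open_facet_nonempty J : exists l, open_facet J l.
Proof.
have [l lE] := exists_indicator J; exists l; exact: indicator_facet.
Qed.

(** [l] lies strictly between [m] and [l + e (l - m)]. *)
Lemma face_absorb F l m (e : R) : is_face F -> F l -> tits_cone D m -> 0 < e ->
  tits_cone D (l + e *: (l - m)) -> F m.
Proof.
move=> [_ _ _ FE] Fl Xm e0 Xp; pose t := (1 + e)^-1.
have e1 : 1 + e != 0 by rewrite gt_eqF //; lra.
have t01 : 0 < t < 1 by rewrite invr_gt0 invf_lt1; lra.
case: (FE _ _ t Xp Xm t01) => //.
suff -> : t *: (l + e *: (l - m)) + (1 - t) *: m = l by [].
have e2 : t * (1 + e) = 1 by rewrite mulVf.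
have e3 : 1 - t = t * e by rewrite -e2; ring.
rewrite e3 -scalerA -scalerDr -addrA -scalerDr subrK -[X in X + _]scale1r -scalerDl.
by rewrite scalerA e2 scale1r.
Qed.

Lemma image_weylV w F l : (weyl_fun w^-1%g @` F) l <-> F (w l).
Proof.
split=> [[m Fm <-]|Fl]; first by rewrite weylVK.
by exists (w l) => //; rewrite weylK.
Qed.

Lemma perturb_off J l x : (forall i, i \notin J -> 0 < pairing l i) ->
  exists2 e : R, 0 < e < 1 &
    forall i, i \notin J -> 0 < pairing (l + e *: x) i.
Proof.
move=> l0; pose a i := if i \in J then 1 else pairing l i.
have [|e e01 eP] := @small_perturbation R _ a (pairing x).
  by move=> i; rewrite /a; case: ifPn => // /l0.
exists e => // i Ji; have := eP i.
by rewrite /a (negPf Ji) pairingD pairingZ.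
Qed.

(** The segment from [m] to [l] can be prolonged a little beyond [l] inside the
facet of [l], because the values off [J] are positive at [l]. *)
Lemma face_contains F J l m : is_face F -> F l -> open_facet J l ->
  tits_cone D m -> (forall i, i \in J -> pairing m i = 0) -> F m.
Proof.
move=> fF Fl Jl Xm m0.
have [e /andP[e0 _] eP] := perturb_off (l - m) (fun i => open_facet_gt0 (i := i) Jl).
apply: face_absorb fF Fl Xm e0 _.
have [dp _] : open_facet J (l + e *: (l - m)).
  apply: open_facetP => // i Ji.
  by rewrite pairingD pairingZ pairingB (open_facet_pairing Jl) ?m0 // !subrr mulr0 addr0.
exact: dominant_tits_cone.
Qed.

Lemma face_facet F J l m : is_face F -> F l -> open_facet J l ->
  open_facet J m -> F m.
Proof.
move=> fF Fl Jl Jm; apply: face_contains fF Fl Jl _ _.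
  by apply: dominant_tits_cone; case: Jm.
by move=> i; apply: open_facet_pairing Jm.
Qed.

(** Let [K1] be the component, [m] the weight in [F_(K \ K1)] with values 0 and
1, and [z0] a weight with values -1 on [K1] and 0 on the rest of [K].  As [K1] is
of finite type, some [w] in [W_K1] makes [z0] nonnegative on [K1], so that
[z0 + N nu] is in [X] for [nu] in [F_K] and [N] large.  The midpoint of this
point and [m] is in [F_K], hence in the face, and therefore so is [m]. *)
Lemma face_drop_finite F K k l : is_face F -> F l -> open_facet K l ->
  k \in K -> finite_type R (principal_submx A (component A K k)) ->
  exists2 m, F m & open_facet (K :\: component A K k)%SET m.
Proof.
move=> fF Fl Kl Kk fin; set K1 := component A K k in fin *.
have K1K : K1 \subset K by exact: component_sub.
have [mu muE] := exists_indicator (K :\: K1)%SET.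
have [nu nuE] := exists_indicator K.
have [z0 z0E] := exists_weight D (fun i => - (i \in K1)%:R).
have irrK1 := @component_irreducible R n A D K k.
have [|w K1w wz0] := finite_type_dominantize irrK1 fin (x := z0).
  by move=> i K1i; rewrite z0E K1i rpredN rpred1.
pose N : R := \sum_i `|pairing (w z0) i|.
have N0 : 0 <= N by apply: sumr_ge0.
have NP i : - N <= pairing (w z0) i.
  have h : `|pairing (w z0) i| <= N by rewrite /N (bigD1 i) //= lerDl sumr_ge0.
  by have := ler_norm (- pairing (w z0) i); rewrite normrN; lra.
pose z := z0 + N *: nu.
have wnu : w nu = nu.
  apply: parabolic_fix K1w _ => i K1i.
  by rewrite nuE (fintype.subsetP K1K _ K1i).
have Xz : tits_cone D z.
  rewrite -(weylK w z); apply: tits_cone_weyl; apply: dominant_tits_cone => i.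
  rewrite -/(pairing (w z) i) /z linearD linearZ /= wnu pairingD pairingZ nuE.
  have [K1i|K1i] := boolP (i \in K1).
    by rewrite (fintype.subsetP K1K _ K1i) mulr0 addr0 wz0.
  have [Ki|Ki] := boolP (i \in K); last by have := NP i; rewrite mulr1; lra.
  rewrite mulr0 addr0 (pairing_parabolic_perp _ K1w) ?z0E ?(negPf K1i) ?oppr0 //.
  move=> j K1j; apply/eqP; apply: contraNT K1i => Aij.
  apply: component_edge K1j Ki _.
  by apply: contraNneq Aij => /(A_zero D) ->.
have Xmu : tits_cone D mu.
  by apply: dominant_tits_cone; case: (indicator_facet muE).
have h : 0 < (2^-1 : R) < 1 by apply/andP; split; lra.
exists mu; last exact: indicator_facet.
have [_ _ _ FE] := fF; case: (FE mu z 2^-1 Xmu Xz h) => //.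
apply: face_facet fF Fl Kl _; apply: open_facetP => i Ki;
  rewrite pairingD !pairingZ muE pairingD pairingZ nuE z0E finset.in_setD.
  by rewrite Ki; case: (i \in K1) => /=; lra.
have /negPf -> : i \notin K1 by apply: contra Ki; apply/fintype.subsetP.
by rewrite (negPf Ki) /=; lra.
Qed.

(** Take [v] in [W_J] and [K] a subset of [J] with [v F_K] in [F] and [#|K|]
minimal; [K] is special by [face_drop_finite].  Put [G = v^-1 F]; it contains
[R(K)] by [face_contains].  Conversely let [x] be in [G] and [w] in [W_K] such
that [w x] is nonnegative on [K].  A point of the segment from [F_K] to [w x]
close to [F_K] is dominant, its zero set is contained in [K], and it belongs to
[w G]; by minimality the zero set is [K], so [w x], and then [x], vanishes
on [K]. *)
Theorem face_std F J l : is_face F -> F l -> open_facet J l ->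
  exists v Theta, [/\ special R A Theta, parabolic D J v, Theta \subset J &
    F = v @` std_face D Theta].
Proof.
move=> fF Fl Jl.
pose P (N : nat) := `[< exists v K m, [/\ parabolic D J v, K \subset J,
  open_facet K m, F (v m) & #|K| = N] >].
have P1 : P #|J|.
  by apply/asboolP; exists 1%g, J, l; split; rewrite ?weyl1 //; apply: parabolic1.
case: (ex_minnP (ex_intro P _ P1)) => N /asboolP.
move=> [v [K [mu [Jv KJ Kmu Fmu <-]]]] minK {P1 N}.
pose G := weyl_fun v^-1%g @` F.
have fG : is_face G by exact: is_face_translate.
have GE x : G x <-> F (v x) by exact: image_weylV.
have Gmu : G mu by apply/GE.
have {}minK w K' x : parabolic D J w -> K' \subset J -> open_facet K' x ->
    G (w x) -> (#|K| <= #|K'|)%N.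
  move=> Jw K'J K'x /GE Gx; apply: minK; apply/asboolP.
  exists (v * w)%g, K', x; split; rewrite ?weylM //; exact: parabolicM.
have sK : special R A K.
  apply: contrapT => /nonspecial_component[k Kk fin].
  have [m Gm Km] := face_drop_finite fG Gmu Kmu Kk fin.
  have KK : (K :\: component A K k)%SET \proper K.
    rewrite finset.properEneq finset.subsetDl andbT; apply/eqP => /setP/(_ k).
    by rewrite finset.in_setD Kk component_refl.
  have := minK 1%g _ m (parabolic1 _ _) (fintype.subset_trans (proper_sub KK) KJ) Km.
  by rewrite weyl1 leqNgt proper_card // => /(_ Gm).
exists v, K; split=> //.
suff GK x : G x <-> std_face D K x.
  rewrite eqEsubset; split=> [x Fx|_ [x /GK/GE Fx <-]] //.
  exists (weyl_fun v^-1%g x); last by rewrite weylVK.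
  by apply/GK/GE; rewrite weylVK.
split=> [Gx|[Xx x0]]; last exact: face_contains fG Gmu Kmu Xx x0.
have Xx : tits_cone D x by case: fG => GX _ _ _; apply: GX.
have [w Kw wx] := tits_cone_dominantize K Xx.
have [e /andP[e0 e1] eP] := perturb_off (w x - mu) (fun i => open_facet_gt0 (i := i) Kmu).
set y := mu + _ in eP.
have yE i : i \in K -> pairing y i = e * pairing (w x) i.
  move=> Ki; rewrite /y pairingD pairingZ pairingB !(open_facet_pairing Kmu) //.
  by rewrite subr0 add0r.
have dy : dominant y.
  move=> i; rewrite -/(pairing y i); have [Ki|/eP/ltW//] := boolP (i \in K).
  by rewrite yE // mulr_ge0 ?wx // ltW.
have zyK : zeros y \subset K.
  apply/fintype.subsetP => i /zerosP yi; apply: contraT => /eP.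
  by rewrite yi ltxx.
have wmu : weyl_fun w^-1%g mu = mu.
  apply: parabolic_fix (parabolicV Kw) _ => i; exact: open_facet_pairing.
have Gy : G (weyl_fun w^-1%g y).
  rewrite /y linearD linearZ linearB /= weylK wmu.
  have -> : mu + e *: (x - mu) = e *: x + (1 - e) *: mu.
    by rewrite scalerBr scalerBl scale1r addrCA.
  have [_ _ Gc _] := fG.
  by have := Gc x mu (Itv01 (ltW e0) (ltW e1)); rewrite !inE; apply.
have := minK w^-1%g (zeros y) y (parabolicS KJ (parabolicV Kw))
  (fintype.subset_trans zyK KJ) (conj dy erefl) Gy.
rewrite (geq_leqif (subset_leqif_cards zyK)) => /eqP zy.
have wx0 i : i \in K -> pairing (w x) i = 0.
  rewrite -{1}zy => yi; have Ki := fintype.subsetP zyK _ yi.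
  move/zerosP: yi; rewrite yE // => /eqP.
  by rewrite mulf_eq0 (gt_eqF e0) => /eqP.
have ewx : x = w x.
  by rewrite -{1}(weylK w x); apply: parabolic_fix (parabolicV Kw) wx0.
by split=> // i Ki; rewrite ewx; apply: wx0.
Qed.

End Faces.

(** * Cosets and facets *)

Section CoxeterComplexTheory.
Local Open Scope ring_scope.
Local Open Scope classical_set_scope.
Variables (R : realType) (n : nat) (A : 'M[int]_n) (D : realization R A).
Implicit Types (i j k : 'I_n) (J K Theta : {set 'I_n}) (s t u v w : weyl D).
Implicit Types (l m x y z : weight D) (F G : set (weight D)).
Implicit Types (V U : coxeter_complex D).

Lemma cc_ext V U : (V : set (weyl D)) = U -> V = U.
Proof.
by case: V U => [V cV] [U cU] /= VU; subst U; congr exist; apply: Prop_irrelevance.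
Qed.

Lemma mem_coset w J v : coset w J v <-> parabolic D J (w^-1 * v)%g.
Proof.
split=> [[u Ju <-]|Jv]; first by rewrite mulKg.
by exists (w^-1 * v)%g => //; apply: mulVKg.
Qed.

(** [W_J] fixes a weight that vanishes on [J] only, and [sigma_i] fixes it only
if it vanishes on [h_i]. *)
Lemma parabolic_simple_mem J i : parabolic D J (simple D i) -> i \in J.
Proof.
move=> Ji; have [l lE] := exists_indicator D J.
have e : simple D i l = l.
  by apply: parabolic_fix Ji _ => j Jj; rewrite lE Jj.
have := pairing_simple_diag i l; rewrite e lE.
case: (i \in J) => //= h; exfalso; move: h {e lE}; lra.
Qed.

Lemma coset_eqP v w J K :
  cc_coset v J = cc_coset w K <-> J = K /\ parabolic D J (v^-1 * w)%g.
Proof.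
split=> [/(congr1 (@cc_set _ _ _ _)) /= e|[<- Jvw]]; last first.
  apply/cc_ext; rewrite /= eqEsubset; split=> u /mem_coset Ju; apply/mem_coset.
    have -> : (w^-1 * u = (v^-1 * w)^-1 * (v^-1 * u))%g.
      by rewrite invgM invgK -mulgA mulVKg.
    exact: parabolicM (parabolicV Jvw) Ju.
  have -> : (v^-1 * u = (v^-1 * w) * (w^-1 * u))%g by rewrite -mulgA mulVKg.
  exact: parabolicM Jvw Ju.
have mem u : parabolic D J (v^-1 * u)%g <-> parabolic D K (w^-1 * u)%g.
  by rewrite -!mem_coset; move: e; rewrite /cc_set /= => ->.
have Jvw : parabolic D J (v^-1 * w)%g.
  by apply/mem; rewrite mulVg; apply: parabolic1.
have Kwv : parabolic D K (w^-1 * v)%g.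
  by apply/mem; rewrite mulVg; apply: parabolic1.
split=> //; apply/eqP; rewrite finset.eqEsubset; apply/andP.
split; apply/fintype.subsetP => i /(parabolic_simple D) Pi; apply: parabolic_simple_mem.
  have /mem : parabolic D J (v^-1 * (v * simple D i))%g by rewrite mulKg.
  by rewrite mulgA => /(parabolicM (parabolicV Kwv)); rewrite mulKg.
have /mem : parabolic D K (w^-1 * (w * simple D i))%g by rewrite mulKg.
by rewrite mulgA => /(parabolicM (parabolicV Jvw)); rewrite mulKg.
Qed.

Lemma cc_cosetP V : exists t J, V = cc_coset t J.
Proof.
case: V => [V [t [J e]]]; exists t, J; exact/cc_ext.
Qed.

Fact translate_is_coset w V : is_coset [set (w * u)%g | u in (V : set (weyl D))].
Proof.
have [v [J ->]] := cc_cosetP V; exists (w * v)%g, J.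
rewrite eqEsubset; split=> [_ [_ [u Ju <-] <-]|_ [u Ju <-]].
  by exists u; rewrite ?mulgA.
by exists (v * u)%g; rewrite ?mulgA //; exists u.
Qed.

Definition translate w V : coxeter_complex D := exist _ _ (translate_is_coset w V).

Lemma translateE w v J : translate w (cc_coset v J) = cc_coset (w * v)%g J.
Proof.
apply/cc_ext; rewrite /= eqEsubset; split=> [_ [_ [u Ju <-] <-]|_ [u Ju <-]].
  by exists u; rewrite ?mulgA.
by exists (v * u)%g; rewrite ?mulgA //; exists u.
Qed.

Lemma translate1 V : translate 1%g V = V.
Proof. by have [t [J ->]] := cc_cosetP V; rewrite translateE mul1g. Qed.

Lemma translateM v w V : translate (v * w)%g V = translate v (translate w V).
Proof. by have [t [J ->]] := cc_cosetP V; rewrite !translateE mulgA. Qed.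

Lemma translate_std w : translate w (cc_std D [set: 'I_n]%SET) = cc_std D [set: 'I_n]%SET.
Proof.
by rewrite translateE; apply/coset_eqP; split=> //; apply: parabolicT.
Qed.

(** The facet [t F_J] of the coset [V = t W_J] is contained in [F]; the choice of
[t] and [J] does not matter by [facet_subE]. *)
Definition facet_sub F V := exists t J,
  V = cc_coset t J /\ forall l, open_facet J l -> F (t l).

Lemma facet_subE F t J :
  facet_sub F (cc_coset t J) <-> forall l, open_facet J l -> F (t l).
Proof.
split=> [[u [K [/coset_eqP[<- Jtu] FK]]] l Jl|Fl]; last by exists t, J.
have <- : weyl_fun (t^-1 * u)%g l = l.
  by apply: parabolic_fix Jtu _ => i; apply: open_facet_pairing.
by rewrite -weylM mulVKg; apply: FK.
Qed.

Lemma facet_sub_meet F t J l :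
  is_face F -> open_facet J l -> F (t l) -> facet_sub F (cc_coset t J).
Proof.
move=> fF Jl Ftl; apply/facet_subE => m Jm; apply/image_weylV.
by apply: face_facet Jl Jm; [exact: is_face_translate|exact/image_weylV].
Qed.

Lemma facet_sub_std F : is_face F -> facet_sub F (cc_std D [set: 'I_n]%SET).
Proof.
move=> fF; apply: (@facet_sub_meet F 1%g [set: 'I_n]%SET 0) => //.
  apply: open_facetP => i; last by rewrite finset.in_setT.
  by move=> _; rewrite /pairing lfunE.
by rewrite weyl1; apply: face0.
Qed.

Lemma facet_sub_tits_cone V : facet_sub (tits_cone D) V.
Proof.
have [t [J ->]] := cc_cosetP V; apply/facet_subE => l [dl _].
by apply: tits_cone_weyl; apply: dominant_tits_cone.
Qed.

Lemma facet_sub_translate F w V :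
  facet_sub F (translate w V) <-> facet_sub (fun l => F (w l)) V.
Proof.
have [t [J ->]] := cc_cosetP V; rewrite translateE !facet_subE.
by split=> h l /h; rewrite weylM.
Qed.

(** A coset in [W_Theta down] contains 1, so it is a [W_K] with [K] containing
[Theta], and its translates by [W_(Theta^perp)] have their facets in [R(Theta)].
Conversely, if [t l] is in [R(Theta)] for some [l] in [F_J], an element [v] of
[W_(Theta^perp)] makes it dominant; by [fundamental_domain] [v t] fixes [l] and
belongs to [W_J], and [J] contains [Theta]. *)
Lemma bad_domainE Theta V : special R A Theta ->
  bad_domain Theta V <-> facet_sub (std_face D Theta) V.
Proof.
move=> sT; split=> [[w [U [Pw + eV]]]|].
  have {eV} -> : V = translate w U by exact/cc_ext.
  have [u [K ->]] := cc_cosetP U; rewrite /cc_down /= /cc_le => TU.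
  have Ku v : parabolic D Theta v -> parabolic D K (u^-1 * v)%g.
    by move=> Tv; apply/mem_coset; apply: TU; apply/mem_coset; rewrite invg1 mul1g.
  have K1 : parabolic D K u^-1%g by rewrite -[u^-1%g]mulg1; apply: Ku; apply: parabolic1.
  have TK i : i \in Theta -> i \in K.
    move=> Ti; apply: parabolic_simple_mem; rewrite -[simple D i](mulVKg u).
    apply: parabolicM; first by rewrite -[u]invgK; apply: parabolicV.
    by apply: Ku; apply: parabolic_simple.
  have -> : cc_coset u K = cc_coset 1%g K by apply/coset_eqP; rewrite mulg1.
  rewrite translateE mulg1; apply/facet_subE => l Kl; split.
    by apply: tits_cone_weyl; apply: dominant_tits_cone; case: Kl.
  move=> i Ti; apply: (etrans (pairing_parabolic_perp _ Pw _)).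
    by move=> j Pj; apply: (perpP D Pj Ti).
  by apply: open_facet_pairing Kl _; apply: TK.
have [t [J ->]] := cc_cosetP V; rewrite facet_subE => h.
have [l Jl] := open_facet_nonempty D J.
have [v [Pv dl l0]] := std_face_dominantize sT (h l Jl).
have [dl' zl] := Jl; rewrite -weylM in dl.
have [el lz] := fundamental_domain dl' dl.
exists v^-1%g, (cc_std D J); split; first exact: parabolicV.
  move=> u /mem_coset; rewrite invg1 mul1g => Tu; apply/mem_coset.
  rewrite invg1 mul1g; apply: parabolicS Tu; apply/fintype.subsetP => i Ti.
  rewrite -zl; apply/zerosP; rewrite -el weylM; exact: l0.
have -> : cc_coset t J = translate v^-1%g (cc_std D J); last by [].
rewrite translateE mulg1; apply/coset_eqP; split=> //.
by rewrite -invgM; apply: parabolicV; rewrite -zl.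
Qed.

End CoxeterComplexTheory.

(** * The action of the face monoid *)

Section BadAction.
Local Open Scope ring_scope.
Local Open Scope classical_set_scope.
Local Open Scope quotient_scope.
Variables (R : realType) (n : nat) (A : 'M[int]_n) (D : realization R A).
Variable std : std_faces D.
Implicit Types (J K Theta : {set 'I_n}) (s t u v w : weyl D).
Implicit Types (V U : coxeter_complex D) (F G : face D) (x y : face_monoid std).

Definition pair_act (p : weyl D * face D) V : coxeter_complex D :=
  if `[< facet_sub (val p.2) V >] then translate p.1 V else cc_std D [set: 'I_n]%SET.

Definition bad_action x V : coxeter_complex D :=
  pair_act (repr (x : {eq_quot (@pair_eqv _ _ _ D)})) V.

(** Two elements of [W] that agree on [t F_J] have the same coset of [W_J] after
multiplication by [t], by [fundamental_domain]. *)
Lemma pair_act_eqv p q V : pair_eqv p q -> pair_act p V = pair_act q V.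
Proof.
move=> /pair_eqvP[e12 e]; rewrite /pair_act -e12; case: asboolP => // pV.
move: pV; have [t [J ->]] := cc_cosetP V; rewrite facet_subE => pJ.
have [l Jl] := open_facet_nonempty D J; have [dl zl] := Jl.
rewrite !translateE; apply/coset_eqP; split=> //.
have el : weyl_fun ((p.1 * t)^-1 * (q.1 * t))%g l = l.
  have eqp : weyl_fun (q.1 * t)%g l = weyl_fun (p.1 * t)%g l.
    by rewrite !weylM e //; apply: pJ.
  by rewrite weylM eqp weylK.
rewrite -zl.
by case: (@fundamental_domain _ _ _ D ((p.1 * t)^-1 * (q.1 * t))%g l); rewrite ?el.
Qed.

Lemma bad_action_class v F V :
  bad_action (fm_class std v F) V = pair_act (v, F) V.
Proof.
apply: pair_act_eqv; apply/(@eqmodP _ (pair_eqv_equiv D)); by rewrite reprK.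
Qed.

Lemma fm_classMP x : exists v F, x = fm_class std v F.
Proof. by have [[v F] ->] := fm_classK x; exists v, F. Qed.

Lemma bad_action_is_monoid_action : is_monoid_action bad_action.
Proof.
split=> [V|x y V].
  rewrite [1%g](_ : _ = fm_class std 1%g (mkface (tits_coneP std))) //.
  rewrite bad_action_class /pair_act /= translate1 asboolT //.
  exact: facet_sub_tits_cone.
have [v [F ->]] := fm_classMP x; have [w [G ->]] := fm_classMP y.
rewrite [(_ * _)%g](_ : _ = fm_mul (fm_class std v F) (fm_class std w G)) //.
rewrite fm_mulE !bad_action_class /pair_act /= translateM.
have [GV|GV] := pselect (facet_sub (val G) V); last first.
  rewrite asboolF ?(asboolF GV); last first.
    move: GV; have [t [J ->]] := cc_cosetP V; rewrite !facet_subE => GV h.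
    by apply: GV => l /h[].
  by rewrite translate_std if_same.
rewrite (asboolT GV); congr (if _ then _ else _); apply/asbool_equiv_eq.
rewrite facet_sub_translate.
move: GV; have [t [J ->]] := cc_cosetP V; rewrite !facet_subE => GV.
split=> [h l /h[/face_translateE]//|h l Jl]; split; last exact: GV.
by apply/face_translateE/h.
Qed.

(** [(v, F)] moves [V <> W_I] to something else than [W_I] exactly if the facet
of [V] is contained in [F].  So the action determines the facets contained in
[F], hence [F] itself, and the cosets [v t W_J], hence the values of [v] on
[F]. *)
Lemma bad_action_is_faithful : is_faithful bad_action.
Proof.
move=> x y; have [v [F ->]] := fm_classMP x; have [w [G ->]] := fm_classMP y.
move=> vw.
have {}vw V : pair_act (v, F) V = pair_act (w, G) V.
  by rewrite -!bad_action_class.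
have sub v1 w1 (F1 G1 : face D) V :
    (forall V, pair_act (v1, F1) V = pair_act (w1, G1) V) ->
    facet_sub (val F1) V -> facet_sub (val G1) V.
  move=> e FV; apply: contrapT => GV; have := e V.
  rewrite /pair_act /= (asboolT FV) (asboolF GV) => /(congr1 (translate v1^-1%g)).
  rewrite -translateM mulVg translate1 translate_std => eV.
  by apply: GV; rewrite eV; apply: facet_sub_std; apply: faceP.
have face_sub (F1 G1 : face D) :
    (forall V, facet_sub (val F1) V -> facet_sub (val G1) V) ->
    forall l, val F1 l -> val G1 l.
  move=> FG l Fl; have [FX _ _ _] := faceP F1.
  have [t [m dm el]] := FX _ Fl; rewrite el in Fl *.
  have Jm : open_facet (zeros m) m by [].
  have /FG/facet_subE : facet_sub (val F1) (cc_coset t (zeros m)).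
    by apply: facet_sub_meet Jm Fl; apply: faceP.
  exact.
have FG : F = G.
  apply: face_ext => l; split; apply: face_sub => V; first exact: (sub v w).
  exact: (sub w v).
subst G; apply/fm_classP/pair_eqvP; split=> //= l Fl.
have [FX _ _ _] := faceP F; have [t [m dm el]] := FX _ Fl.
have Jm : open_facet (zeros m) m by [].
have FV : facet_sub (val F) (cc_coset t (zeros m)).
  by apply: facet_sub_meet Jm _; [apply: faceP|rewrite -el].
have := vw (cc_coset t (zeros m)).
rewrite /pair_act /= (asboolT FV) !translateE => /coset_eqP[_ Jvw].
have /(congr1 (weyl_fun (v * t)%g)) : weyl_fun ((v * t)^-1 * (w * t))%g m = m.
  by apply: parabolic_fix Jvw _ => i; apply: open_facet_pairing.
by rewrite -weylM mulVKg !weylM -el.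
Qed.

Lemma bad_action_is_bad_action : is_bad_action bad_action.
Proof.
move=> s1 s2 Theta sT t J.
rewrite [(_ * _)%g](_ : _ = fm_mul (fm_mul (fm_weyl std s1)
  (fm_idem std (stdF std sT))) (fm_weyl std s2)) //.
rewrite /fm_weyl /fm_idem !fm_mulE mulg1 bad_action_class /pair_act /= translateE.
congr (if _ then _ else _); apply/asbool_equiv_eq.
rewrite bad_domainE // !facet_subE; split=> h l Jl.
  by case: (h l Jl) => /image_weylV[_]; rewrite weylM.
have := h l Jl; rewrite weylM => hl; split.
  apply/image_weylV; split=> //; apply/image_weylV.
  by rewrite weyl1; case: hl.
apply: tits_cone_weyl; apply: dominant_tits_cone; by case: Jl.
Qed.

Lemma bad_action_stabilizer J :
  stabilizer bad_action (cc_std D J) = parabolic_submonoid std J.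
Proof.
rewrite eqEsubset; split=> x.
- have [v [F ->]] := fm_classMP x; rewrite /stabilizer /= bad_action_class /pair_act /=.
  case: asboolP => [FJ|FJ]; last first.
    move=> /coset_eqP[eJ _]; case: FJ; rewrite -eJ.
    by apply: facet_sub_std; apply: faceP.
  rewrite translateE mulg1 => /coset_eqP[_]; rewrite mulg1 => /parabolicV.
  rewrite invgK => Jv; move: FJ; rewrite facet_subE => FJ.
  have [l Jl] := open_facet_nonempty D J.
  have := FJ l Jl; rewrite weyl1 => Fl.
  have [u [Theta [sT Ju TJ eF]]] := face_std (faceP F) Fl Jl.
  exists v, u, Theta, sT; split=> //; congr fm_class.
  by apply: val_inj.
- case=> v [u [Theta [sT [Jv Ju TJ ->]]]].
  rewrite /stabilizer /= bad_action_class /pair_act /= asboolT.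
    rewrite translateE mulg1; apply/coset_eqP; split=> //.
    by rewrite mulg1; apply: parabolicV.
  apply/facet_subE => l Jl; rewrite weyl1; exists l; last first.
    by apply: parabolic_fix Ju _ => i; apply: open_facet_pairing.
  split; first by apply: dominant_tits_cone; case: Jl.
  by move=> i Ti; apply: open_facet_pairing Jl _; apply: fintype.subsetP Ti.
Qed.

(** The element [eps(R(Theta))] fixes [W_Theta], but sends the larger element
[{1}] of the complex to [W_I]. *)
Lemma bad_action_not_order_preserving
    (act : face_monoid std -> coxeter_complex D -> coxeter_complex D) Theta :
  is_bad_action act -> special R A Theta -> Theta <> finset.set0 ->
  Theta <> [set: 'I_n]%SET -> ~ is_order_preserving act.
Proof.
move=> bad sT T0 TI ord.
have /ord : cc_le (cc_coset 1%g Theta) (cc_coset (1%g : weyl D) finset.set0).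
  move=> u /mem_coset Ju; apply/mem_coset; apply: parabolicS Ju.
  exact: finset.sub0set.
move=> /(_ (fm_weyl std 1 * fm_idem std (stdF std sT) * fm_weyl std 1)%g).
rewrite !bad !mulg1 asboolT; last first.
  exists 1%g, (cc_std D Theta); split; first exact: parabolic1.
    by [].
  by rewrite -[LHS](congr1 (@cc_set _ _ _ _) (translate1 _)).
rewrite asboolF => [TIle|]; last first.
  have [i Ti] : exists i, i \in Theta by apply/set0Pn/eqP.
  case=> w [U [_ TU eU]].
  have mem u : parabolic D Theta u -> parabolic D finset.set0 (w * u)%g.
    move=> Tu; have /mem_coset : coset 1%g finset.set0 (w * u)%g.
      rewrite -[coset _ _]/((cc_coset _ _ : coxeter_complex D) : set _) eU.
      by exists u => //; apply: TU; apply/mem_coset; rewrite invg1 mul1g.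
    by rewrite invg1 mul1g.
  have h1 := mem _ (parabolic1 D Theta).
  have h2 := mem _ (parabolic_simple D Ti).
  rewrite mulg1 in h1.
  have := parabolicM (parabolicV h1) h2; rewrite mulKg => /parabolic_simple_mem.
  by rewrite finset.in_set0.
apply: TI; apply/setP => i; rewrite finset.in_setT.
apply: (@parabolic_simple_mem _ _ _ D).
have /TIle/mem_coset : (cc_std D [set: 'I_n]%SET : set _) (simple D i).
  by apply/mem_coset; apply: parabolicT.
by rewrite invg1 mul1g.
Qed.

End BadAction.

(** * A matrix with a proper special subset *)

Section Example.
Local Open Scope ring_scope.
Variable R : realType.

Lemma free_image (n : nat) (V : vectType R) (f : 'I_n -> V) :
  (forall c : 'I_n -> R, \sum_i c i *: f i = 0 -> forall i, c i = 0) ->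
  free [seq f i | i : 'I_n].
Proof.
move=> fr; pose X := [tuple of [seq f i | i : 'I_n]].
suff: free X by [].
apply/freeP => c c0 a.
have XE (b : 'I_#|'I_n|) : X`_b = f (enum_val b) by exact: nth_image.
have := fr (fun i => c (enum_rank i)) _ (enum_val a); rewrite enum_valK; apply.
rewrite -[RHS]c0 (reindex (fun b : 'I_#|'I_n| => enum_val b)); last first.
  by apply: onW_bij; apply: enum_val_bij.
by apply: eq_bigr => b _; rewrite enum_valK XE.
Qed.

(** The matrix is invertible, so the coroots may be the standard basis of [R^3];
each principal block of size two is affine, so any two indices form a special
subset. *)
Definition ex_cartan : 'M[int]_3 := \matrix_(i, j) (if i == j then 2 else -2).

Let M : 'M[R]_3 := map_mx intr ex_cartan.

Lemma ex_cartanE i j : M i j = if i == j then 2 else -2.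
Proof. by rewrite !mxE; case: eqP => _; rewrite ?rmorphN. Qed.

Lemma ex_inverse : M *m (\matrix_(i, j) (if i == j then 0 else - 4^-1)) = 1%:M.
Proof.
apply/matrixP => i j; rewrite [LHS]mxE [RHS]mxE !big_ord_recl big_ord0.
rewrite !ex_cartanE ![in LHS]mxE.
by case: i j => [[|[|[|//]]] ?] [[|[|[|//]]] ?]; rewrite -!(inj_eq val_inj) /=; lra.
Qed.

Lemma ex_unit : M \in unitmx.
Proof. by case: (mulmx1_unit ex_inverse). Qed.

Lemma ex_gcm : gcm ex_cartan.
Proof.
split=> [i|i j|i j]; rewrite ?mxE ?eqxx //; first by move/negPf->.
by case: eqP.
Qed.

Lemma ex_symmetrizable : symmetrizable R ex_cartan.
Proof.
exists (const_mx 1), M; split=> [i||].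
- by rewrite mxE oner_neq0.
- by apply/matrixP => i j; rewrite mxE !ex_cartanE eq_sym.
- by rewrite diag_const_mx mul1mx.
Qed.

Definition ex_root_fun (j : 'I_3) (h : 'rV[R]_3) : R^o := (h *m M) 0 j.

Fact ex_root_is_linear j : linear (ex_root_fun j).
Proof. by move=> a u v; rewrite /ex_root_fun mulmxDl -scalemxAl !mxE. Qed.

HB.instance Definition _ j :=
  GRing.isLinear.Build R 'rV[R]_3 R^o _ (ex_root_fun j) (ex_root_is_linear j).

Definition ex_root j : 'Hom('rV[R]_3, R^o) := linfun (ex_root_fun j).

Lemma ex_rootE i j : ex_root j (delta_mx 0 i : 'rV[R]_3) = (ex_cartan i j)%:~R.
Proof. by rewrite lfunE /= /ex_root_fun -rowE !mxE. Qed.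

Lemma ex_dim : \dim {: 'rV[R]_3} = (2 * 3 - \rank M)%N.
Proof. by rewrite mxrank_unit ?ex_unit // dimvf /dim /=. Qed.

Lemma ex_coroot_free : free [seq (delta_mx 0 i : 'rV[R]_3) | i : 'I_3].
Proof.
apply: free_image => c c0 i.
have cE : \row_j c j = 0 :> 'rV[R]_3.
  by rewrite -[RHS]c0 [LHS]row_sum_delta; apply: eq_bigr => j _; rewrite mxE.
by have := congr1 (fun v : 'rV[R]_3 => v 0 i) cE; rewrite !mxE.
Qed.

Lemma ex_root_free : free [seq ex_root i | i : 'I_3].
Proof.
apply: free_image => c c0 i.
have Mc : M *m \col_j c j = 0.
  apply/colP => k; rewrite mxE [RHS]mxE.
  have := congr1 (fun f : 'Hom('rV[R]_3, R^o) => f (delta_mx 0 k)) c0.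
  rewrite sum_lfunE zero_lfunE; apply: etrans; apply: eq_bigr => j _.
  by rewrite scale_lfunE ex_rootE mxE mulrC !mxE.
have := congr1 (fun v : 'cV[R]_3 => v i 0) (mulKmx ex_unit (\col_j c j)).
by rewrite Mc mulmx0 !mxE.
Qed.

Definition ex_realization : realization R ex_cartan :=
  Realization ex_gcm ex_symmetrizable ex_dim ex_coroot_free ex_root_free ex_rootE.

Definition ex_Theta : {set 'I_3} := [set i | i != ord_max]%SET.

Lemma ex_special : special R ex_cartan ex_Theta.
Proof.
apply: contrapT => /nonspecial_component[k Tk].
have -> : component ex_cartan ex_Theta k = ex_Theta.
  apply/setP => j; rewrite in_component; have [Tj|//] := boolP (j \in ex_Theta).
  have [->|kj] := eqVneq k j; first by rewrite connect0.
  apply: connect1; apply/and4P; split=> //.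
  by rewrite mxE (negPf kj).
(* the rows of the block sum to zero, so -(1, 1) contradicts finite type *)
pose a0 := enum_rank_in Tk k.
case=> _ _ /(_ (const_mx (-1))) [a|/(_ a0)|/colP/(_ a0)].
- have -> : (map_mx intr (principal_submx ex_cartan ex_Theta)
     *m const_mx (-1) : 'cV[R]_#|ex_Theta|) a 0 = - \sum_(j in ex_Theta) M (enum_val a) j.
    rewrite mxE [in RHS]big_enum_val /= -sumrN; apply: eq_bigr => b _.
    by rewrite !mxE mulrN1.
  rewrite big_mkcond !big_ord_recl big_ord0 /= !finset.in_set !ex_cartanE.
  have := enum_valP a; move: (enum_val a) => {}a.
  rewrite finset.in_set; case: a => [[|[|[|//]]] ?]; 
   rewrite -!(inj_eq val_inj) //= => _; lra.
- by rewrite mxE; lra.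
- by rewrite !mxE => /eqP; rewrite oppr_eq0 oner_eq0.
Qed.

Lemma ex_Theta_proper : ex_Theta <> finset.set0 /\ ex_Theta <> [set: 'I_3]%SET.
Proof.
split=> /setP.
  by move=> /(_ ord0); rewrite !finset.in_set -(inj_eq val_inj).
by move=> /(_ ord_max); rewrite !finset.in_set eqxx.
Qed.

End Example.

Theorem proposition4p4 (R : realType) :
  (forall (n : nat) (A : 'M[int]_n) (D : realization R A),
    exists (std : std_faces D)
      (act : face_monoid std -> coxeter_complex D -> coxeter_complex D),
      [/\ is_bad_action act,
          is_monoid_action act,
          is_faithful act,
          (exists2 Theta : {set 'I_n}, special R A Theta &
             Theta <> finset.set0 /\ Theta <> [set: 'I_n]%SET) ->
            ~ is_order_preserving act &
          forall J : {set 'I_n},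
            stabilizer act (cc_std D J) = parabolic_submonoid std J]) /\
  (exists (n : nat) (A : 'M[int]_n) (D : realization R A) (std : std_faces D)
      (act : face_monoid std -> coxeter_complex D -> coxeter_complex D),
      is_bad_action act /\ ~ is_order_preserving act).
Proof.
split.
  move=> n A D; exists (std_facesT D), (@bad_action _ _ _ _ (std_facesT D)); split.
  - exact: bad_action_is_bad_action.
  - exact: bad_action_is_monoid_action.
  - exact: bad_action_is_faithful.
  - case=> Theta sT [T0 TI]; apply: bad_action_not_order_preserving sT T0 TI.
    exact: bad_action_is_bad_action.
  - exact: bad_action_stabilizer.
pose std := std_facesT (ex_realization R).
exists 3, ex_cartan, (ex_realization R), std, (@bad_action _ _ _ _ std).
have bad := @bad_action_is_bad_action _ _ _ _ std; split=> //.
have [T0 TI] := ex_Theta_proper.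
exact: bad_action_not_order_preserving bad (ex_special R) T0 TI.
Qed.
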